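(* The following is provable in $\mathsf{RCA}_0$: every partial order which contains neither $\mathbf{2}\oplus\mathbf{2}$ nor $\mathbf{3}\oplus\mathbf{1}$ is a proper interval order.
   Context: $\mathsf{RCA}_0$ is the base subsystem of second-order arithmetic ($\Delta^0_1$ comprehension, $\Sigma^0_1$ induction). A partial order $\mathbf{P}=(P,\leq_P)$ is a set $P\subseteq\mathbb{N}$ with a reflexive, transitive, antisymmetric relation; a linear order has any two elements comparable; $p<_P q$ means $p\leq_P q$, $p\ne q$. $\mathbf{P}$ is a proper interval order if there are a linear order $\mathbf{L}=(L,\leq_L)$ and $F\subseteq P\times L$ such that, with $F(p)=\{x:(p,x)\in F\}$: (i1) each $F(p)$ is nonempty and convex ($x,y\in F(p)$, $x<_L z<_L y$ imply $z\in F(p)$); (i2) $p<_P q$ iff $x<_L y$ for all $x\in F(p),y\in F(q)$; (i4) $F(p)\subseteq F(q)$ implies $F(p)=F(q)$ for all $p,q$. $\mathbf{P}$ does not contain $\mathbf{2}\oplus\mathbf{2}$ if $p_0<_P q_0$, $p_1<_P q_1$ imply $p_0\leq_P q_1$ or $p_1\leq_P q_0$; it does not contain $\mathbf{3}\oplus\mathbf{1}$ if for all $p_0,p_1,p_2,q\in P$, $p_0<_P p_1<_P p_2$ implies $p_0\leq_P q$ or $q\leq_P p_2$. *)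

(* Defs.v *)
From Stdlib Require Import List.
Import ListNotations.

(** * Second-order arithmetic, RCA_0, and interval orders in its language

    Deep embedding of the language L_2 of second-order arithmetic (as in
    Simpson, "Subsystems of Second Order Arithmetic"), with de Bruijn indices.
    Number variables and set variables are two independent index spaces:
    [#k] is the k-th enclosing number quantifier, a set index [X : nat] is
    the X-th enclosing set quantifier, and a number quantifier does not shift
    set indices (nor conversely).  Equality is primitive for numbers only. *)

Inductive term : Type :=
| tvar (n : nat)
| tzero
| tone
| tadd (s t : term)
| tmul (s t : term).

Inductive form : Type :=
| fbot
| feq (s t : term)
| flt (s t : term)
| fmem (t : term) (X : nat)
| fand (A B : form)
| for_ (A B : form)
| fimp (A B : form)
| fall1 (A : form)
| fex1 (A : form)
| fall2 (A : form)
| fex2 (A : form).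

Definition fneg (A : form) : form := fimp A fbot.
Definition fiff (A B : form) : form := fand (fimp A B) (fimp B A).

Declare Scope form_scope.
Delimit Scope form_scope with form.
Bind Scope form_scope with form.
Open Scope form_scope.

Notation "# k" := (tvar k) (at level 5, k at level 0, format "# k").
Notation "s '≈' t" := (feq s t) (at level 60, no associativity) : form_scope.
Notation "s '≺' t" := (flt s t) (at level 60, no associativity) : form_scope.
Notation "t '∊' X" := (fmem t X) (at level 60, no associativity) : form_scope.
Notation "'∼' A" := (fneg A) (at level 35, right associativity) : form_scope.
Notation "A '⩓' B" := (fand A B) (at level 70, right associativity) : form_scope.
Notation "A '⩔' B" := (for_ A B) (at level 75, right associativity) : form_scope.
Notation "A '⇒' B" := (fimp A B) (at level 80, right associativity) : form_scope.
Notation "A '⇔' B" := (fiff A B) (at level 85, no associativity) : form_scope.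
Notation "'∀₁' A" := (fall1 A) (at level 90, right associativity) : form_scope.
Notation "'∃₁' A" := (fex1 A) (at level 90, right associativity) : form_scope.
Notation "'∀₂' A" := (fall2 A) (at level 90, right associativity) : form_scope.
Notation "'∃₂' A" := (fex2 A) (at level 90, right associativity) : form_scope.

(** ** Substitution

    The only set terms are set variables, so the set part of a substitution is
    a renaming. *)

Fixpoint tsubst (σ : nat -> term) (t : term) : term :=
  match t with
  | tvar n => σ n
  | tzero => tzero
  | tone => tone
  | tadd s t => tadd (tsubst σ s) (tsubst σ t)
  | tmul s t => tmul (tsubst σ s) (tsubst σ t)
  end.

Definition tlift (t : term) : term := tsubst (fun n => #(S n)) t.

Definition scons {A : Type} (a : A) (f : nat -> A) (n : nat) : A :=
  match n with 0 => a | S m => f m end.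

Definition up1 (σ : nat -> term) : nat -> term := scons #0 (fun n => tlift (σ n)).
Definition up2 (ξ : nat -> nat) : nat -> nat := scons 0 (fun n => S (ξ n)).

Fixpoint subst (σ : nat -> term) (ξ : nat -> nat) (A : form) : form :=
  match A with
  | fbot => fbot
  | feq s t => feq (tsubst σ s) (tsubst σ t)
  | flt s t => flt (tsubst σ s) (tsubst σ t)
  | fmem t X => fmem (tsubst σ t) (ξ X)
  | fand A B => fand (subst σ ξ A) (subst σ ξ B)
  | for_ A B => for_ (subst σ ξ A) (subst σ ξ B)
  | fimp A B => fimp (subst σ ξ A) (subst σ ξ B)
  | fall1 A => fall1 (subst (up1 σ) ξ A)
  | fex1 A => fex1 (subst (up1 σ) ξ A)
  | fall2 A => fall2 (subst σ (up2 ξ) A)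
  | fex2 A => fex2 (subst σ (up2 ξ) A)
  end.

Definition lift1 (A : form) : form := subst (fun n => #(S n)) (fun X => X) A.
Definition lift2 (A : form) : form := subst tvar S A.
Definition inst1 (A : form) (t : term) : form := subst (scons t tvar) (fun X => X) A.
Definition inst2 (A : form) (X : nat) : form := subst tvar (scons X (fun Y => Y)) A.

(** ** Classical two-sorted natural deduction with equality

    In [d_ax] an axiom with free variables stands for its universal closure:
    it is available under any context, so generalization over its free
    variables is always possible. *)

Inductive derives (T : form -> Prop) : list form -> form -> Prop :=
| d_ax Γ A : T A -> derives T Γ A
| d_hyp Γ A : In A Γ -> derives T Γ A
| d_raa Γ A : derives T (∼ A :: Γ) fbot -> derives T Γ A
| d_impI Γ A B : derives T (A :: Γ) B -> derives T Γ (A ⇒ B)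
| d_impE Γ A B : derives T Γ (A ⇒ B) -> derives T Γ A -> derives T Γ B
| d_andI Γ A B : derives T Γ A -> derives T Γ B -> derives T Γ (A ⩓ B)
| d_andE1 Γ A B : derives T Γ (A ⩓ B) -> derives T Γ A
| d_andE2 Γ A B : derives T Γ (A ⩓ B) -> derives T Γ B
| d_orI1 Γ A B : derives T Γ A -> derives T Γ (A ⩔ B)
| d_orI2 Γ A B : derives T Γ B -> derives T Γ (A ⩔ B)
| d_orE Γ A B C : derives T Γ (A ⩔ B) -> derives T (A :: Γ) C ->
    derives T (B :: Γ) C -> derives T Γ C
| d_all1I Γ A : derives T (map lift1 Γ) A -> derives T Γ (∀₁ A)
| d_all1E Γ A t : derives T Γ (∀₁ A) -> derives T Γ (inst1 A t)
| d_ex1I Γ A t : derives T Γ (inst1 A t) -> derives T Γ (∃₁ A)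
| d_ex1E Γ A C : derives T Γ (∃₁ A) -> derives T (A :: map lift1 Γ) (lift1 C) ->
    derives T Γ C
| d_all2I Γ A : derives T (map lift2 Γ) A -> derives T Γ (∀₂ A)
| d_all2E Γ A X : derives T Γ (∀₂ A) -> derives T Γ (inst2 A X)
| d_ex2I Γ A X : derives T Γ (inst2 A X) -> derives T Γ (∃₂ A)
| d_ex2E Γ A C : derives T Γ (∃₂ A) -> derives T (A :: map lift2 Γ) (lift2 C) ->
    derives T Γ C
| d_refl Γ t : derives T Γ (t ≈ t)
| d_leibniz Γ A s t : derives T Γ (s ≈ t) -> derives T Γ (inst1 A s) ->
    derives T Γ (inst1 A t).

Definition provable (T : form -> Prop) (A : form) : Prop := derives T [] A.

(** ** The arithmetical hierarchy up to the first level *)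

(** [tlift t] expresses that the bound does not contain the bounded variable. *)
Inductive Delta00 : form -> Prop :=
| D_bot : Delta00 fbot
| D_eq s t : Delta00 (s ≈ t)
| D_lt s t : Delta00 (s ≺ t)
| D_mem t X : Delta00 (t ∊ X)
| D_and A B : Delta00 A -> Delta00 B -> Delta00 (A ⩓ B)
| D_or A B : Delta00 A -> Delta00 B -> Delta00 (A ⩔ B)
| D_imp A B : Delta00 A -> Delta00 B -> Delta00 (A ⇒ B)
| D_ball t A : Delta00 A -> Delta00 (∀₁ (#0 ≺ tlift t ⇒ A))
| D_bex t A : Delta00 A -> Delta00 (∃₁ (#0 ≺ tlift t ⩓ A)).

Definition Sigma01 (A : form) : Prop := exists B, Delta00 B /\ A = ∃₁ B.
Definition Pi01 (A : form) : Prop := exists B, Delta00 B /\ A = ∀₁ B.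

(** ** RCA_0 *)

Definition tsucc (t : term) : term := tadd t tone.

(** [A(n+1)], for [A] in which [n] is [#0], in the scope of [n]. *)
Definition step (A : form) : form :=
  subst (scons (tsucc #0) (fun k => #(S k))) (fun X => X) A.

(** The free variables of the schemata other than [n = #0] are parameters.  In
    comprehension, [lift2] ensures that the set being defined is not free in
    the defining formula. *)
Inductive RCA0 : form -> Prop :=
| ax_succ_nonzero : RCA0 (∀₁ ∼ (tsucc #0 ≈ tzero))
| ax_succ_inj : RCA0 (∀₁ ∀₁ (tsucc #1 ≈ tsucc #0 ⇒ #1 ≈ #0))
| ax_add_zero : RCA0 (∀₁ (tadd #0 tzero ≈ #0))
| ax_add_succ : RCA0 (∀₁ ∀₁ (tadd #1 (tsucc #0) ≈ tsucc (tadd #1 #0)))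
| ax_mul_zero : RCA0 (∀₁ (tmul #0 tzero ≈ tzero))
| ax_mul_succ : RCA0 (∀₁ ∀₁ (tmul #1 (tsucc #0) ≈ tadd (tmul #1 #0) #1))
| ax_lt_zero : RCA0 (∀₁ ∼ (#0 ≺ tzero))
| ax_lt_succ : RCA0 (∀₁ ∀₁ (#1 ≺ tsucc #0 ⇔ (#1 ≺ #0 ⩔ #1 ≈ #0)))
| ax_Sigma01_induction A : Sigma01 A ->
    RCA0 (inst1 A tzero ⩓ (∀₁ (A ⇒ step A)) ⇒ ∀₁ A)
| ax_Delta01_comprehension A B : Sigma01 A -> Pi01 B ->
    RCA0 ((∀₁ (A ⇔ B)) ⇒ ∃₂ ∀₁ (#0 ∊ 0 ⇔ lift2 A)).

(** ** Orders in the language of second-order arithmetic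

    Pairs are coded by [(s,t) = (s+t)^2 + s]; binary relations are sets of
    codes.  The parameters [P R L Q F] below are indices of set variables. *)

Definition pair (s t : term) : term := tadd (tmul (tadd s t) (tadd s t)) s.

Definition all_in (X : nat) (A : form) : form := ∀₁ (#0 ∊ X ⇒ A).

Definition rel (R : nat) (s t : term) : form := pair s t ∊ R.

Definition strict (R : nat) (s t : term) : form := rel R s t ⩓ ∼ (s ≈ t).

(** F ⊆ X × Y *)
Definition sub_prod (F X Y : nat) : form :=
  all_in F (∃₁ ∃₁ (#1 ∊ X ⩓ #0 ∊ Y ⩓ #2 ≈ pair #1 #0)).

Definition partial_order (P R : nat) : form :=
  sub_prod R P P
  ⩓ all_in P (rel R #0 #0)
  ⩓ all_in P (all_in P (all_in P (rel R #2 #1 ⇒ rel R #1 #0 ⇒ rel R #2 #0)))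
  ⩓ all_in P (all_in P (rel R #1 #0 ⇒ rel R #0 #1 ⇒ #1 ≈ #0)).

Definition linear_order (L Q : nat) : form :=
  partial_order L Q
  ⩓ all_in L (all_in L (rel Q #1 #0 ⩔ rel Q #0 #1)).

(** p0, q0, p1, q1 = #3, #2, #1, #0 *)
Definition no_2_plus_2 (P R : nat) : form :=
  all_in P (all_in P (all_in P (all_in P
    (strict R #3 #2 ⇒ strict R #1 #0 ⇒ rel R #3 #0 ⩔ rel R #1 #2)))).

(** p0, p1, p2, q = #3, #2, #1, #0 *)
Definition no_3_plus_1 (P R : nat) : form :=
  all_in P (all_in P (all_in P (all_in P
    (strict R #3 #2 ⇒ strict R #2 #1 ⇒ rel R #3 #0 ⩔ rel R #0 #1)))).

(** x ∈ F(p) *)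
Definition in_val (F : nat) (p x : term) : form := pair p x ∊ F.

(** Conditions (i1), (i2), (i4).  In convexity, p, x, y, z = #3, #2, #1, #0;
    in (i2), p, q = #1, #0 on the left and p, q, x, y = #3, #2, #1, #0 on the
    right; in (i4), p, q, x = #2, #1, #0. *)
Definition values_nonempty_convex (P L Q F : nat) : form :=
  all_in P (∃₁ in_val F #1 #0)
  ⩓ all_in P (all_in L (all_in L (all_in L
      (in_val F #3 #2 ⇒ in_val F #3 #1 ⇒
       strict Q #2 #0 ⇒ strict Q #0 #1 ⇒ in_val F #3 #0)))).

Definition values_represent (P R L Q F : nat) : form :=
  all_in P (all_in P (strict R #1 #0 ⇔
    all_in L (all_in L
      (in_val F #3 #1 ⇒ in_val F #2 #0 ⇒ strict Q #1 #0)))).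

Definition values_proper (P F : nat) : form :=
  all_in P (all_in P
    ((∀₁ (in_val F #2 #0 ⇒ in_val F #1 #0)) ⇒
     (∀₁ (in_val F #2 #0 ⇔ in_val F #1 #0)))).

(** Below the three set quantifiers, L, Q, F are 2, 1, 0. *)
Definition proper_interval_order (P R : nat) : form :=
  ∃₂ ∃₂ ∃₂
    (linear_order 2 1
     ⩓ sub_prod 0 (3 + P) 2
     ⩓ values_nonempty_convex (3 + P) 2 1 0
     ⩓ values_represent (3 + P) (3 + R) 2 1 0
     ⩓ values_proper (3 + P) 0).

(* Main.v *)
From Stdlib Require Import List Arith Lia Classical ClassicalEpsilon.
From Stdlib Require Import FunctionalExtensionality PropExtensionality ProofIrrelevance Cantor.
Require Import Defs.
Import ListNotations.

(** The calculus is complete for Henkin models, so it suffices to argue inside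
    an arbitrary model of RCA_0.  Order the left and right endpoints of the
    intervals-to-be: [p] starts (and ends) before [q] when its predecessors are
    predecessors of [q] and the successors of [q] are successors of [p]; the
    right endpoint of [p] precedes the left endpoint of [q] iff [p < q].
    Without 2+2 and 3+1 this is a total preorder, but it is only Pi^0_1.
    Its stage-[m] approximation, which only uses elements below [m] as
    witnesses, is decidable, is a total preorder on the endpoints below [m],
    and decreases with [m].  A point of the linear order is a cut: an initial
    segment of the endpoints at some stage, extended recursively to endpoints
    born later by placing a newcomer on the left when it is, at its birth, below
    something on the left.  Such a cut is an initial segment at all later
    stages, hence any two cuts are comparable, and their inclusion can be
    decided by looking at an initial part.  Put into F(p) the cuts separating
    the left from the right endpoint of [p].  If a cut in F(q) is not in F(p),
    two left or two right endpoints of [p] and [q] are separated at some stage,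
    and cutting there yields a point of F(p) outside F(q). *)

(** * Algebra of substitutions *)

Lemma tsubst_comp (σ τ : nat -> term) (t : term) :
  tsubst τ (tsubst σ t) = tsubst (fun n => tsubst τ (σ n)) t.
Proof. induction t; simpl; congruence. Qed.

Lemma tsubst_id (t : term) : tsubst tvar t = t.
Proof. induction t; simpl; congruence. Qed.

Lemma tsubst_lift (σ : nat -> term) (t : term) :
  tsubst σ (tlift t) = tsubst (fun n => σ (S n)) t.
Proof. unfold tlift. rewrite tsubst_comp. reflexivity. Qed.

Lemma up1_comp (σ τ : nat -> term) :
  (fun n => tsubst (up1 τ) (up1 σ n)) = up1 (fun n => tsubst τ (σ n)).
Proof.
  apply functional_extensionality. intros [|n]; [reflexivity|].
  simpl. rewrite tsubst_lift. unfold tlift. rewrite tsubst_comp. reflexivity.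
Qed.

Lemma up2_comp (ξ ζ : nat -> nat) :
  (fun n => up2 ζ (up2 ξ n)) = up2 (fun n => ζ (ξ n)).
Proof. apply functional_extensionality. intros [|n]; reflexivity. Qed.

Lemma up1_id : up1 tvar = tvar.
Proof. apply functional_extensionality. intros [|n]; reflexivity. Qed.

Lemma up2_id : up2 (fun X => X) = (fun X => X).
Proof. apply functional_extensionality. intros [|n]; reflexivity. Qed.

Lemma subst_comp (A : form) : forall σ τ ξ ζ,
  subst τ ζ (subst σ ξ A) = subst (fun n => tsubst τ (σ n)) (fun X => ζ (ξ X)) A.
Proof.
  induction A; intros σ τ ξ ζ; simpl;
    rewrite ?tsubst_comp, ?IHA1, ?IHA2, ?IHA, ?up1_comp, ?up2_comp; reflexivity.
Qed.

Lemma subst_id (A : form) : subst tvar (fun X => X) A = A.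
Proof.
  induction A; simpl; rewrite ?tsubst_id, ?up1_id, ?up2_id; congruence.
Qed.

Lemma subst_lift1 (σ : nat -> term) (ξ : nat -> nat) (A : form) :
  subst (up1 σ) ξ (lift1 A) = lift1 (subst σ ξ A).
Proof. unfold lift1. rewrite !subst_comp. reflexivity. Qed.

Lemma subst_lift2 (σ : nat -> term) (ξ : nat -> nat) (A : form) :
  subst σ (up2 ξ) (lift2 A) = lift2 (subst σ ξ A).
Proof.
  unfold lift2. rewrite !subst_comp. f_equal.
  apply functional_extensionality. intros n. simpl. symmetry. apply tsubst_id.
Qed.

Lemma inst1_up1 (σ : nat -> term) (ξ : nat -> nat) (A : form) (t : term) :
  inst1 (subst (up1 σ) ξ A) t = subst (scons t σ) ξ A.
Proof.
  unfold inst1. rewrite subst_comp. f_equal.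
  apply functional_extensionality. intros [|n]; [reflexivity|].
  simpl. rewrite tsubst_lift. apply tsubst_id.
Qed.

Lemma inst2_up2 (σ : nat -> term) (ξ : nat -> nat) (A : form) (X : nat) :
  inst2 (subst σ (up2 ξ) A) X = subst σ (scons X ξ) A.
Proof.
  unfold inst2. rewrite subst_comp. f_equal; apply functional_extensionality.
  - intros n. apply tsubst_id.
  - intros [|n]; reflexivity.
Qed.

Lemma subst_inst1 (σ : nat -> term) (ξ : nat -> nat) (A : form) (t : term) :
  subst σ ξ (inst1 A t) = inst1 (subst (up1 σ) ξ A) (tsubst σ t).
Proof.
  rewrite inst1_up1. unfold inst1. rewrite subst_comp. f_equal.
  apply functional_extensionality. intros [|n]; reflexivity.
Qed.

Lemma subst_inst2 (σ : nat -> term) (ξ : nat -> nat) (A : form) (X : nat) :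
  subst σ ξ (inst2 A X) = inst2 (subst σ (up2 ξ) A) (ξ X).
Proof.
  rewrite inst2_up2. unfold inst2. rewrite subst_comp. f_equal.
  apply functional_extensionality. intros [|n]; reflexivity.
Qed.

(** * Completeness of the calculus for Henkin models *)

(** Free variables of axioms stand for arbitrary terms. Closure under substitution lets a whole
    derivation be renamed, which is how fresh variables come to serve as Henkin witnesses. *)
Definition subst_closed (T : form -> Prop) : Prop :=
  forall A σ ξ, T A -> T (subst σ ξ A).

Lemma derives_weaken (T : form -> Prop) (Γ Γ' : list form) (A : form) :
  derives T Γ A -> incl Γ Γ' -> derives T Γ' A.
Proof.
  intros H. revert Γ'. induction H; intros Γ' Hi.
  - now apply d_ax.
  - apply d_hyp, Hi, H.
  - apply d_raa, IHderives. now apply incl_cons; [left|apply incl_tl].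
  - apply d_impI, IHderives. now apply incl_cons; [left|apply incl_tl].
  - eapply d_impE; eauto.
  - apply d_andI; auto.
  - eapply d_andE1; eauto.
  - eapply d_andE2; eauto.
  - apply d_orI1; auto.
  - apply d_orI2; auto.
  - eapply d_orE; [auto|apply IHderives2|apply IHderives3];
      now apply incl_cons; [left|apply incl_tl].
  - apply d_all1I, IHderives, incl_map, Hi.
  - apply d_all1E; auto.
  - eapply d_ex1I; eauto.
  - eapply d_ex1E; [auto|apply IHderives2].
    apply incl_cons; [now left|apply incl_tl, incl_map, Hi].
  - apply d_all2I, IHderives, incl_map, Hi.
  - apply d_all2E; auto.
  - eapply d_ex2I; eauto.
  - eapply d_ex2E; [auto|apply IHderives2].
    apply incl_cons; [now left|apply incl_tl, incl_map, Hi].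
  - apply d_refl.
  - eapply d_leibniz; eauto.
Qed.

Lemma map_lift1_subst (σ : nat -> term) (ξ : nat -> nat) (Γ : list form) :
  map (subst (up1 σ) ξ) (map lift1 Γ) = map lift1 (map (subst σ ξ) Γ).
Proof. rewrite !map_map. apply map_ext, subst_lift1. Qed.

Lemma map_lift2_subst (σ : nat -> term) (ξ : nat -> nat) (Γ : list form) :
  map (subst σ (up2 ξ)) (map lift2 Γ) = map lift2 (map (subst σ ξ) Γ).
Proof. rewrite !map_map. apply map_ext, subst_lift2. Qed.

(** Substitution commutes with the lifting of contexts, so each eigenvariable rule carries over once
    the substitution has passed under the binder by [up1] or [up2]. *)
Lemma derives_subst (T : form -> Prop) (Γ : list form) (A : form) :
  subst_closed T -> derives T Γ A ->
  forall σ ξ, derives T (map (subst σ ξ) Γ) (subst σ ξ A).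
Proof.
  intros HT H. induction H; intros σ ξ; simpl in *.
  - apply d_ax, HT, H.
  - apply d_hyp, in_map, H.
  - apply d_raa, IHderives.
  - apply d_impI, IHderives.
  - eapply d_impE; [apply IHderives1|apply IHderives2].
  - apply d_andI; auto.
  - eapply d_andE1, IHderives.
  - eapply d_andE2, IHderives.
  - apply d_orI1; auto.
  - apply d_orI2; auto.
  - eapply d_orE; [apply IHderives1|apply IHderives2|apply IHderives3].
  - apply d_all1I. rewrite <- map_lift1_subst. apply IHderives.
  - rewrite subst_inst1. apply d_all1E, IHderives.
  - eapply d_ex1I. rewrite <- subst_inst1. apply IHderives.
  - eapply d_ex1E; [apply IHderives1|].
    rewrite <- map_lift1_subst, <- subst_lift1. apply IHderives2.
  - apply d_all2I. rewrite <- map_lift2_subst. apply IHderives.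
  - rewrite subst_inst2. apply d_all2E, IHderives.
  - eapply d_ex2I. rewrite <- subst_inst2. apply IHderives.
  - eapply d_ex2E; [apply IHderives1|].
    rewrite <- map_lift2_subst, <- subst_lift2. apply IHderives2.
  - apply d_refl.
  - rewrite subst_inst1. eapply d_leibniz; [apply IHderives1|].
    rewrite <- subst_inst1. apply IHderives2.
Qed.

(** * Henkin models and satisfaction *)

Record model : Type := {
  num : Type;
  sets : Type;
  mzero : num;
  mone : num;
  madd : num -> num -> num;
  mmul : num -> num -> num;
  mlt : num -> num -> Prop;
  mmem : num -> sets -> Prop }.

Fixpoint eval (M : model) (e : nat -> num M) (t : term) : num M :=
  match t with
  | tvar n => e n
  | tzero => mzero M
  | tone => mone M
  | tadd s t => madd M (eval M e s) (eval M e t)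
  | tmul s t => mmul M (eval M e s) (eval M e t)
  end.

Fixpoint sat (M : model) (e : nat -> num M) (f : nat -> sets M) (A : form) : Prop :=
  match A with
  | fbot => False
  | feq s t => eval M e s = eval M e t
  | flt s t => mlt M (eval M e s) (eval M e t)
  | fmem t X => mmem M (eval M e t) (f X)
  | fand A B => sat M e f A /\ sat M e f B
  | for_ A B => sat M e f A \/ sat M e f B
  | fimp A B => sat M e f A -> sat M e f B
  | fall1 A => forall x, sat M (scons x e) f A
  | fex1 A => exists x, sat M (scons x e) f A
  | fall2 A => forall X, sat M e (scons X f) A
  | fex2 A => exists X, sat M e (scons X f) A
  end.

Lemma eval_tsubst (M : model) (e : nat -> num M) (σ : nat -> term) (t : term) :
  eval M e (tsubst σ t) = eval M (fun n => eval M e (σ n)) t.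
Proof. induction t; simpl; congruence. Qed.

Lemma eval_up1 (M : model) (e : nat -> num M) (σ : nat -> term) (x : num M) :
  (fun n => eval M (scons x e) (up1 σ n)) = scons x (fun n => eval M e (σ n)).
Proof.
  apply functional_extensionality. intros [|n]; [reflexivity|].
  simpl. unfold tlift. rewrite eval_tsubst. reflexivity.
Qed.

Lemma scons_up2 (M : model) (f : nat -> sets M) (ξ : nat -> nat) (X : sets M) :
  (fun n => scons X f (up2 ξ n)) = scons X (fun n => f (ξ n)).
Proof. apply functional_extensionality. intros [|n]; reflexivity. Qed.

Lemma forall_iff {A : Type} (P Q : A -> Prop) :
  (forall x, P x <-> Q x) -> (forall x, P x) <-> (forall x, Q x).
Proof. firstorder. Qed.

Lemma exists_iff {A : Type} (P Q : A -> Prop) :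
  (forall x, P x <-> Q x) -> (exists x, P x) <-> (exists x, Q x).
Proof. firstorder. Qed.

Lemma sat_subst (M : model) (A : form) : forall e f σ ξ,
  sat M e f (subst σ ξ A) <-> sat M (fun n => eval M e (σ n)) (fun X => f (ξ X)) A.
Proof.
  induction A; intros e g σ ξ; simpl; rewrite ?eval_tsubst, ?IHA1, ?IHA2; try reflexivity.
  - apply forall_iff. intros x. rewrite IHA, eval_up1. reflexivity.
  - apply exists_iff. intros x. rewrite IHA, eval_up1. reflexivity.
  - apply forall_iff. intros X. rewrite IHA, scons_up2. reflexivity.
  - apply exists_iff. intros X. rewrite IHA, scons_up2. reflexivity.
Qed.

(** ** Fresh variables and enumeration of formulas *)

Fixpoint tbound (t : term) : nat :=
  match t with
  | tvar n => S n
  | tzero | tone => 0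
  | tadd s t | tmul s t => Nat.max (tbound s) (tbound t)
  end.

Fixpoint bound1 (A : form) : nat :=
  match A with
  | fbot => 0
  | feq s t | flt s t => Nat.max (tbound s) (tbound t)
  | fmem t _ => tbound t
  | fand A B | for_ A B | fimp A B => Nat.max (bound1 A) (bound1 B)
  | fall1 A | fex1 A => pred (bound1 A)
  | fall2 A | fex2 A => bound1 A
  end.

Fixpoint bound2 (A : form) : nat :=
  match A with
  | fbot | feq _ _ | flt _ _ => 0
  | fmem _ X => S X
  | fand A B | for_ A B | fimp A B => Nat.max (bound2 A) (bound2 B)
  | fall1 A | fex1 A => bound2 A
  | fall2 A | fex2 A => pred (bound2 A)
  end.

Lemma tsubst_ext_bound (σ τ : nat -> term) (t : term) :
  (forall n, n < tbound t -> σ n = τ n) -> tsubst σ t = tsubst τ t.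
Proof.
  induction t; simpl; intros H; auto.
  - rewrite IHt1, IHt2; auto; intros n Hn; apply H; lia.
  - rewrite IHt1, IHt2; auto; intros n Hn; apply H; lia.
Qed.

Lemma subst_ext_bound (A : form) : forall σ τ ξ ζ,
  (forall n, n < bound1 A -> σ n = τ n) ->
  (forall X, X < bound2 A -> ξ X = ζ X) ->
  subst σ ξ A = subst τ ζ A.
Proof.
  induction A; simpl; intros σ τ ξ ζ H1 H2;
    try (f_equal; first [apply tsubst_ext_bound; intros; apply H1; lia
                        | apply H2; lia
                        | apply IHA1; intros; first [apply H1; lia|apply H2; lia]
                        | apply IHA2; intros; first [apply H1; lia|apply H2; lia]]; fail).
  - reflexivity.
  - f_equal. apply IHA; auto. intros [|n] Hn; simpl; [reflexivity|]. rewrite H1; [reflexivity|lia].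
  - f_equal. apply IHA; auto. intros [|n] Hn; simpl; [reflexivity|]. rewrite H1; [reflexivity|lia].
  - f_equal. apply IHA; auto. intros [|n] Hn; simpl; [reflexivity|]. rewrite H2; [reflexivity|lia].
  - f_equal. apply IHA; auto. intros [|n] Hn; simpl; [reflexivity|]. rewrite H2; [reflexivity|lia].
Qed.

Fixpoint tcode (t : term) : nat :=
  match t with
  | tvar n => to_nat (0, n)
  | tzero => to_nat (1, 0)
  | tone => to_nat (2, 0)
  | tadd s t => to_nat (3, to_nat (tcode s, tcode t))
  | tmul s t => to_nat (4, to_nat (tcode s, tcode t))
  end.

Fixpoint fcode (A : form) : nat :=
  match A with
  | fbot => to_nat (0, 0)
  | feq s t => to_nat (1, to_nat (tcode s, tcode t))
  | flt s t => to_nat (2, to_nat (tcode s, tcode t))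
  | fmem t X => to_nat (3, to_nat (tcode t, X))
  | fand A B => to_nat (4, to_nat (fcode A, fcode B))
  | for_ A B => to_nat (5, to_nat (fcode A, fcode B))
  | fimp A B => to_nat (6, to_nat (fcode A, fcode B))
  | fall1 A => to_nat (7, fcode A)
  | fex1 A => to_nat (8, fcode A)
  | fall2 A => to_nat (9, fcode A)
  | fex2 A => to_nat (10, fcode A)
  end.

Ltac code_inj :=
  repeat match goal with
  | H : to_nat _ = to_nat _ |- _ =>
      apply to_nat_inj, pair_equal_spec in H; destruct H; try discriminate
  end.

Lemma tcode_inj (s : term) : forall t, tcode s = tcode t -> s = t.
Proof.
  induction s; intros [] H; cbn [tcode] in H; code_inj; subst;
    f_equal; auto.
Qed.

Lemma fcode_inj (A : form) : forall B, fcode A = fcode B -> A = B.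
Proof.
  induction A; intros [] H; cbn [fcode] in H; code_inj; subst;
    f_equal; auto using tcode_inj.
Qed.

(** An injective code suffices: each formula appears at index [fcode A], and an index that is no
    code yields an arbitrary formula. *)
Definition form_enum (n : nat) : form := epsilon (inhabits fbot) (fun A => fcode A = n).

Lemma form_enum_fcode (A : form) : form_enum (fcode A) = A.
Proof.
  apply fcode_inj. unfold form_enum.
  apply (epsilon_spec (inhabits fbot) (fun B => fcode B = fcode A)). now exists A.
Qed.

(** * Maximal consistent sets with witnesses *)

Section Henkin.

Variable T : form -> Prop.
Hypothesis HT : subst_closed T.

Definition consistent (Γ : list form) : Prop := ~ derives T Γ fbot.

(** Contexts are finite lists, so a variable above all free ones exists and no new constants have to
    be added to the language. *)
Definition fresh1 (Γ : list form) : nat := list_max (map bound1 Γ).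
Definition fresh2 (Γ : list form) : nat := list_max (map bound2 Γ).

Lemma bound1_fresh Γ A : In A Γ -> bound1 A <= fresh1 Γ.
Proof.
  intros H. pose proof (proj1 (list_max_le (map bound1 Γ) (fresh1 Γ)) (le_n _)) as HF.
  rewrite Forall_forall in HF. apply HF, in_map, H.
Qed.

Lemma bound2_fresh Γ A : In A Γ -> bound2 A <= fresh2 Γ.
Proof.
  intros H. pose proof (proj1 (list_max_le (map bound2 Γ) (fresh2 Γ)) (le_n _)) as HF.
  rewrite Forall_forall in HF. apply HF, in_map, H.
Qed.

Lemma witness1_consistent Γ A :
  In (∃₁ A) Γ -> consistent Γ -> consistent (inst1 A #(fresh1 Γ) :: Γ).
Proof.
  intros HA HΓ H. apply HΓ. apply d_ex1E with A; [now apply d_hyp|].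
  set (k := fresh1 Γ) in *.
  (* Renaming [k] to the bound variable [0] turns the instance back into [A]. *)
  set (ρ := fun n => if n =? k then #0 else #(S n)).
  apply derives_subst with (σ := ρ) (ξ := fun X => X) in H; [|exact HT].
  simpl in H. eapply derives_weaken; [exact H|].
  assert (Hρ : forall n, n < k -> ρ n = #(S n)).
  { intros n Hn. unfold ρ. destruct (Nat.eqb_spec n k); [lia|reflexivity]. }
  apply incl_cons.
  - left. unfold inst1. rewrite subst_comp. rewrite <- (subst_id A) at 1.
    apply subst_ext_bound; [|reflexivity].
    intros [|n] Hn; simpl.
    + unfold ρ. now rewrite Nat.eqb_refl.
    + symmetry. apply Hρ. pose proof (bound1_fresh _ _ HA) as HB. simpl in HB. fold k in HB. lia.
  - intros B HB. right. apply in_map_iff in HB as (C & <- & HC). apply in_map_iff.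
    exists C. split; [|exact HC]. apply subst_ext_bound; [|reflexivity].
    intros n Hn. symmetry. apply Hρ. pose proof (bound1_fresh _ _ HC) as HB. fold k in HB. lia.
Qed.

(** Renaming the fresh set index to 0 turns the instance into the body, and the derivation into the
    minor premise of [d_ex2E]. *)
Lemma witness2_consistent Γ A :
  In (∃₂ A) Γ -> consistent Γ -> consistent (inst2 A (fresh2 Γ) :: Γ).
Proof.
  intros HA HΓ H. apply HΓ. apply d_ex2E with A; [now apply d_hyp|].
  set (k := fresh2 Γ) in *.
  set (ρ := fun n => if n =? k then 0 else S n).
  apply derives_subst with (σ := tvar) (ξ := ρ) in H; [|exact HT].
  simpl in H. eapply derives_weaken; [exact H|].
  assert (Hρ : forall n, n < k -> ρ n = S n).
  { intros n Hn. unfold ρ. destruct (Nat.eqb_spec n k); [lia|reflexivity]. }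
  apply incl_cons.
  - left. unfold inst2. rewrite subst_comp. rewrite <- (subst_id A) at 1.
    apply subst_ext_bound; [reflexivity|].
    intros [|n] Hn; simpl.
    + unfold ρ. now rewrite Nat.eqb_refl.
    + symmetry. apply Hρ. pose proof (bound2_fresh _ _ HA) as HB. simpl in HB. fold k in HB. lia.
  - intros B HB. right. apply in_map_iff in HB as (C & <- & HC). apply in_map_iff.
    exists C. split; [|exact HC]. apply subst_ext_bound; [reflexivity|].
    intros n Hn. symmetry. apply Hρ. pose proof (bound2_fresh _ _ HC) as HB. fold k in HB. lia.
Qed.

Definition add_witness (A : form) (Γ : list form) : list form :=
  match A with
  | fex1 B => inst1 B #(fresh1 Γ) :: Γ
  | fex2 B => inst2 B (fresh2 Γ) :: Γ
  | _ => Γ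
  end.

Lemma add_witness_consistent A Γ : In A Γ -> consistent Γ -> consistent (add_witness A Γ).
Proof.
  intros HA HΓ. destruct A; simpl; auto using witness1_consistent, witness2_consistent.
Qed.

Lemma add_witness_incl A Γ : incl Γ (add_witness A Γ).
Proof. destruct A; simpl; auto using incl_refl, incl_tl. Qed.

Variable Γ0 : list form.
Hypothesis HΓ0 : consistent Γ0.

(** Lindenbaum's construction. The witness is chosen fresh for the list that already contains the
    formula, and enters together with it. *)
Fixpoint stage (n : nat) : list form :=
  match n with
  | 0 => Γ0
  | S n =>
      let A := form_enum n in
      if excluded_middle_informative (consistent (A :: stage n))
      then add_witness A (A :: stage n) else stage n
  end.

Lemma stage_consistent n : consistent (stage n).
Proof.
  induction n as [|n IH]; [exact HΓ0|].
  cbn [stage]. cbv zeta. destruct (excluded_middle_informative _) as [H|H]; [|exact IH].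
  apply add_witness_consistent; [now left|exact H].
Qed.

Lemma stage_incl n m : n <= m -> incl (stage n) (stage m).
Proof.
  induction 1 as [|m _ IH]; [apply incl_refl|].
  eapply incl_tran; [exact IH|]. cbn [stage]. cbv zeta.
  destruct (excluded_middle_informative _); [|apply incl_refl].
  eapply incl_tran; [|apply add_witness_incl]. apply incl_tl, incl_refl.
Qed.

Definition thm (A : form) : Prop := exists n, In A (stage n).

(** The formula [A] is examined at stage [fcode A]; being consistent with that stage, it enters with
    its witness. This one fact yields both maximality and the Henkin property. *)
Lemma thm_maximal A : (forall n, consistent (A :: stage n)) ->
  exists n, incl (add_witness A (A :: stage (fcode A))) (stage n).
Proof.
  intros H. exists (S (fcode A)). cbn [stage]. cbv zeta. rewrite form_enum_fcode.
  destruct (excluded_middle_informative _) as [_|Hn]; [apply incl_refl|].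
  now destruct Hn.
Qed.

(** If [A] were inconsistent with some stage, a cut at a later stage containing both contexts would
    refute that stage. *)
Lemma thm_derives n A : derives T (stage n) A -> thm A.
Proof.
  intros HA. destruct (thm_maximal A) as [m Hm].
  - intros k Hk. apply (stage_consistent (Nat.max n k)).
    apply d_impE with A.
    + apply d_impI. eapply derives_weaken; [exact Hk|].
      apply incl_cons; [now left|]. apply incl_tl, stage_incl. lia.
    + eapply derives_weaken; [exact HA|]. apply stage_incl. lia.
  - exists m. apply Hm, add_witness_incl. now left.
Qed.

Lemma thm_inv A : thm A -> exists n, derives T (stage n) A.
Proof. intros [n Hn]. exists n. now apply d_hyp. Qed.

Lemma thm_rule1 A B : (forall Γ, derives T Γ A -> derives T Γ B) -> thm A -> thm B.
Proof. intros H HA. apply thm_inv in HA as [n Hn]. eapply thm_derives, H, Hn. Qed.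

Lemma thm_rule2 A B C :
  (forall Γ, derives T Γ A -> derives T Γ B -> derives T Γ C) -> thm A -> thm B -> thm C.
Proof.
  intros H HA HB. apply thm_inv in HA as [n Hn]. apply thm_inv in HB as [m Hm].
  apply (thm_derives (Nat.max n m)), H; eapply derives_weaken; eauto; apply stage_incl; lia.
Qed.

Lemma thm_valid A : (forall Γ, derives T Γ A) -> thm A.
Proof. intros H. apply (thm_derives 0), H. Qed.

Lemma thm_bot : ~ thm fbot.
Proof. intros H. apply thm_inv in H as [n Hn]. now apply stage_consistent in Hn. Qed.

Lemma thm_neg A : thm (∼ A) <-> ~ thm A.
Proof.
  split.
  - intros H1 H2. apply thm_bot. revert H1 H2; apply thm_rule2. intros Γ. apply d_impE.
  - intros H. apply NNPP. intros HN. apply H. destruct (thm_maximal A) as [m Hm].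
    + intros k Hk. apply HN. apply (thm_derives k), d_impI, Hk.
    + exists m. apply Hm, add_witness_incl. now left.
Qed.

Lemma thm_and A B : thm (A ⩓ B) <-> thm A /\ thm B.
Proof.
  split.
  - intros H. split; revert H; apply thm_rule1; intros Γ; [apply d_andE1|apply d_andE2].
  - intros [HA HB]. revert HA HB. apply thm_rule2. intros Γ. apply d_andI.
Qed.

Lemma thm_or A B : thm (A ⩔ B) <-> thm A \/ thm B.
Proof.
  split.
  - intros H. apply NNPP. intros HN. apply thm_bot.
    assert (HA : thm (∼ A)) by (apply thm_neg; tauto).
    assert (HB : thm (∼ B)) by (apply thm_neg; tauto).
    generalize (proj2 (thm_and _ _) (conj HA HB)). revert H. apply thm_rule2. intros Γ H1 H2.
    eapply d_orE; [exact H1| |]; eapply d_impE; try (apply d_hyp; now left).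
    + eapply derives_weaken; [eapply d_andE1, H2|]. apply incl_tl, incl_refl.
    + eapply derives_weaken; [eapply d_andE2, H2|]. apply incl_tl, incl_refl.
  - intros [H|H]; revert H; apply thm_rule1; intros Γ; [apply d_orI1|apply d_orI2].
Qed.

Lemma thm_imp A B : thm (A ⇒ B) <-> (thm A -> thm B).
Proof.
  split.
  - apply thm_rule2. intros Γ. apply d_impE.
  - intros H. destruct (classic (thm A)) as [HA|HA].
    + generalize (H HA). apply thm_rule1. intros Γ HB. apply d_impI.
      eapply derives_weaken; [exact HB|]. apply incl_tl, incl_refl.
    + apply thm_neg in HA. revert HA. apply thm_rule1. intros Γ HN. apply d_impI, d_raa.
      eapply d_impE; [|apply d_hyp; right; now left].
      eapply derives_weaken; [exact HN|]. now do 2 apply incl_tl.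
Qed.

Lemma thm_ex1 A : thm (∃₁ A) <-> exists t, thm (inst1 A t).
Proof.
  split.
  - intros H. destruct (thm_maximal (∃₁ A)) as [m Hm].
    + intros k Hk. destruct H as [n Hn]. apply (stage_consistent (Nat.max n k)).
      eapply derives_weaken; [exact Hk|].
      apply incl_cons; [revert Hn; apply stage_incl|apply stage_incl]; lia.
    + eexists. exists m. apply Hm. now left.
  - intros [t H]. revert H. apply thm_rule1. intros Γ. apply d_ex1I.
Qed.

Lemma thm_ex2 A : thm (∃₂ A) <-> exists X, thm (inst2 A X).
Proof.
  split.
  - intros H. destruct (thm_maximal (∃₂ A)) as [m Hm].
    + intros k Hk. destruct H as [n Hn]. apply (stage_consistent (Nat.max n k)).
      eapply derives_weaken; [exact Hk|].
      apply incl_cons; [revert Hn; apply stage_incl|apply stage_incl]; lia.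
    + eexists. exists m. apply Hm. now left.
  - intros [t H]. revert H. apply thm_rule1. intros Γ. apply d_ex2I.
Qed.

Lemma thm_all1 A : thm (∀₁ A) <-> forall t, thm (inst1 A t).
Proof.
  split.
  - intros H t. revert H. apply thm_rule1. intros Γ. apply d_all1E.
  - intros H. apply NNPP. intros HN. apply thm_neg in HN.
    (* The classical duality is derived inside the calculus; the existential then supplies a term
       refuting the hypothesis. *)
    assert (HE : thm (∃₁ ∼ A)).
    { revert HN. apply thm_rule1. intros Γ HN. apply d_raa.
      apply d_impE with (∀₁ A).
      - eapply derives_weaken; [exact HN|]. apply incl_tl, incl_refl.
      - apply d_all1I, d_raa. eapply d_impE.
        + apply d_hyp. right. simpl. left. reflexivity.
        (* Under the binder the eigenvariable is [#0], and instantiating the lifted body at it gives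
           the body back. *)
        + apply d_ex1I with #0. apply d_hyp. left.
          unfold inst1. rewrite subst_comp. simpl. unfold fneg. f_equal.
          rewrite <- (subst_id A) at 1. f_equal. symmetry.
          apply functional_extensionality. now intros [|n]. }
    apply thm_ex1 in HE as [t Ht]. apply (proj1 (thm_neg (inst1 A t)) Ht), H.
Qed.

Lemma thm_all2 A : thm (∀₂ A) <-> forall X, thm (inst2 A X).
Proof.
  split.
  - intros H t. revert H. apply thm_rule1. intros Γ. apply d_all2E.
  - intros H. apply NNPP. intros HN. apply thm_neg in HN.
    assert (HE : thm (∃₂ ∼ A)).
    { revert HN. apply thm_rule1. intros Γ HN. apply d_raa.
      apply d_impE with (∀₂ A).
      - eapply derives_weaken; [exact HN|]. apply incl_tl, incl_refl.
      - apply d_all2I, d_raa. eapply d_impE.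
        + apply d_hyp. right. simpl. left. reflexivity.
        + apply d_ex2I with 0. apply d_hyp. left.
          unfold inst2. rewrite subst_comp. simpl. unfold fneg. f_equal.
          rewrite <- (subst_id A) at 1. f_equal. symmetry.
          apply functional_extensionality. now intros [|n]. }
    apply thm_ex2 in HE as [t Ht]. apply (proj1 (thm_neg (inst2 A t)) Ht), H.
Qed.

(** ** The term model *)

Definition teq (s t : term) : Prop := thm (s ≈ t).

Lemma teq_leibniz A s t : teq s t -> thm (inst1 A s) -> thm (inst1 A t).
Proof. apply thm_rule2. intros Γ. apply d_leibniz. Qed.

Lemma teq_refl t : teq t t.
Proof. apply thm_valid. intros Γ. apply d_refl. Qed.

Lemma inst1_tlift s t : tsubst (scons t tvar) (tlift s) = s.
Proof. rewrite tsubst_lift. apply tsubst_id. Qed.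

Lemma teq_sym s t : teq s t -> teq t s.
Proof.
  intros H. generalize (teq_leibniz (#0 ≈ tlift s) s t H). unfold inst1. simpl.
  rewrite !inst1_tlift. intros K. apply K, teq_refl.
Qed.

Lemma teq_trans s t u : teq s t -> teq t u -> teq s u.
Proof.
  intros H1 H2. generalize (teq_leibniz (tlift s ≈ #0) t u H2). unfold inst1. simpl.
  rewrite !inst1_tlift. intros K. apply K, H1.
Qed.

Lemma teq_tadd s s' t t' : teq s s' -> teq t t' -> teq (tadd s t) (tadd s' t').
Proof.
  intros H1 H2. apply teq_trans with (tadd s' t).
  - generalize (teq_leibniz (tadd (tlift s) (tlift t) ≈ tadd #0 (tlift t)) s s' H1).
    unfold inst1. simpl. rewrite !inst1_tlift. intros K. apply K, teq_refl.
  - generalize (teq_leibniz (tadd (tlift s') (tlift t) ≈ tadd (tlift s') #0) t t' H2).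
    unfold inst1. simpl. rewrite !inst1_tlift. intros K. apply K, teq_refl.
Qed.

Lemma teq_tmul s s' t t' : teq s s' -> teq t t' -> teq (tmul s t) (tmul s' t').
Proof.
  intros H1 H2. apply teq_trans with (tmul s' t).
  - generalize (teq_leibniz (tmul (tlift s) (tlift t) ≈ tmul #0 (tlift t)) s s' H1).
    unfold inst1. simpl. rewrite !inst1_tlift. intros K. apply K, teq_refl.
  - generalize (teq_leibniz (tmul (tlift s') (tlift t) ≈ tmul (tlift s') #0) t t' H2).
    unfold inst1. simpl. rewrite !inst1_tlift. intros K. apply K, teq_refl.
Qed.

Lemma teq_flt s s' t t' : teq s s' -> teq t t' -> thm (s ≺ t) -> thm (s' ≺ t').
Proof.
  intros H1 H2 H.
  generalize (teq_leibniz (#0 ≺ tlift t) s s' H1). unfold inst1. simpl.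
  rewrite !inst1_tlift. intros K. specialize (K H).
  generalize (teq_leibniz (tlift s' ≺ #0) t t' H2). unfold inst1. simpl.
  rewrite !inst1_tlift. auto.
Qed.

Lemma teq_fmem s s' X : teq s s' -> thm (s ∊ X) -> thm (s' ∊ X).
Proof.
  intros H1 H. generalize (teq_leibniz (#0 ∊ X) s s' H1). unfold inst1. simpl. auto.
Qed.

(** Satisfaction interprets [≈] by equality in the metatheory, so the elements must be classes of
    provably equal terms. A class is a predicate, and extensionality identifies classes with the
    same members. *)
Definition tclass : Type := {c : term -> Prop | exists t, c = teq t}.
Definition cls (t : term) : tclass := exist _ (teq t) (ex_intro _ t eq_refl).
Definition rep (c : tclass) : term :=
  proj1_sig (constructive_indefinite_description _ (proj2_sig c)).

Lemma cls_rep c : cls (rep c) = c.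
Proof.
  unfold rep. destruct (constructive_indefinite_description _ _) as [t Ht]. simpl.
  destruct c as [c Hc]. simpl in Ht. apply subset_eq_compat. now symmetry.
Qed.

Lemma cls_eq s t : cls s = cls t <-> teq s t.
Proof.
  split.
  - intros H. apply (f_equal (@proj1_sig _ _)) in H. simpl in H.
    rewrite H. apply teq_refl.
  - intros H. assert (E : teq s = teq t).
    { apply functional_extensionality. intros u. apply propositional_extensionality.
      split; intros K; eauto using teq_trans, teq_sym. }
    apply subset_eq_compat, E.
Qed.

Lemma teq_rep t : teq (rep (cls t)) t.
Proof. apply cls_eq, cls_rep. Qed.

(** The set variables themselves are the sets: the language has no equality of sets, so this sort
    needs no quotient. *)
Definition term_model : model := {|
  num := tclass;
  sets := nat;
  mzero := cls tzero;
  mone := cls tone;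
  madd c d := cls (tadd (rep c) (rep d));
  mmul c d := cls (tmul (rep c) (rep d));
  mlt c d := thm (rep c ≺ rep d);
  mmem c X := thm (rep c ∊ X) |}.

Lemma eval_term_model (σ : nat -> term) (t : term) :
  eval term_model (fun n => cls (σ n)) t = cls (tsubst σ t).
Proof.
  induction t; simpl; auto; rewrite IHt1, IHt2; apply cls_eq;
    auto using teq_tadd, teq_tmul, teq_rep.
Qed.

Lemma scons_cls (σ : nat -> term) (t : term) :
  scons (cls t) (fun n => cls (σ n)) = (fun n => cls (scons t σ n)).
Proof. apply functional_extensionality. now intros [|n]. Qed.

(** The truth lemma. Arbitrary [σ] and [ξ] are carried along so that a quantifier only extends them
    by [scons]. *)
Lemma sat_term_model (A : form) : forall σ ξ,
  sat term_model (fun n => cls (σ n)) ξ A <-> thm (subst σ ξ A).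
Proof.
  induction A; intros σ ξ; cbn [sat subst]; rewrite ?eval_term_model.
  - split; [easy|apply thm_bot].
  - apply cls_eq.
  - simpl. split; apply teq_flt; auto using teq_rep, teq_sym.
  - simpl. split; apply teq_fmem; auto using teq_rep, teq_sym.
  - rewrite IHA1, IHA2. symmetry. apply thm_and.
  - rewrite IHA1, IHA2. symmetry. apply thm_or.
  - rewrite IHA1, IHA2. symmetry. apply thm_imp.
  - rewrite thm_all1. split.
    + intros H t. rewrite inst1_up1. apply IHA. rewrite <- scons_cls. apply H.
    + intros H c. rewrite <- (cls_rep c), scons_cls. apply IHA. rewrite <- inst1_up1. apply H.
  - rewrite thm_ex1. split.
    + intros [c H]. exists (rep c). rewrite inst1_up1. apply IHA.
      rewrite <- scons_cls, cls_rep. apply H.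
    + intros [t H]. exists (cls t). rewrite scons_cls. apply IHA. rewrite <- inst1_up1. apply H.
  - rewrite thm_all2. split.
    + intros H X. rewrite inst2_up2. apply IHA, H.
    + intros H X. apply IHA. rewrite <- inst2_up2. apply H.
  - rewrite thm_ex2. split.
    + intros [X H]. exists X. rewrite inst2_up2. apply IHA, H.
    + intros [X H]. exists X. apply IHA. rewrite <- inst2_up2. apply H.
Qed.

End Henkin.

Theorem completeness (T : form -> Prop) (A : form) :
  subst_closed T ->
  (forall M : model, (forall B e f, T B -> sat M e f B) -> forall e f, sat M e f A) ->
  provable T A.
Proof.
  intros HT H. apply NNPP. intros HN.
  assert (HC : consistent T [∼ A]).
  { intros HD. apply HN. apply d_raa, HD. }
  pose (M := term_model T [∼ A]).
  assert (HM : forall B e f, T B -> sat M e f B).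
  { intros B e f HB.
    (* Every assignment arises from a substitution by choosing representatives, so the truth lemma
       applies to it. *)
    assert (He : e = (fun n => cls T [∼ A] (rep T [∼ A] (e n)))).
    { apply functional_extensionality. intros n. symmetry. apply cls_rep. }
    rewrite He. apply sat_term_model; auto. apply thm_valid; auto.
    intros Γ. apply d_ax, HT, HB. }
  (* Under the identity assignment the truth lemma turns truth of [A] into membership in the maximal
     set, which contains [∼ A]. *)
  specialize (H M HM (fun n => cls T [∼ A] #n) (fun X => X)).
  apply sat_term_model in H; auto. rewrite subst_id in H.
  revert H. apply thm_neg; auto. exists 0. now left.
Qed.

(** * Models of RCA_0 and definable predicates *)

Lemma tsubst_up1_tlift (σ : nat -> term) (t : term) :
  tsubst (up1 σ) (tlift t) = tlift (tsubst σ t).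
Proof. rewrite tsubst_lift. unfold tlift. now rewrite tsubst_comp. Qed.

Lemma Delta00_subst (A : form) : Delta00 A -> forall σ ξ, Delta00 (subst σ ξ A).
Proof.
  intros H. induction H; intros σ ξ; simpl; try (constructor; auto; fail).
  - rewrite tsubst_up1_tlift. now constructor.
  - rewrite tsubst_up1_tlift. now constructor.
Qed.

Lemma subst_step (σ : nat -> term) (ξ : nat -> nat) (A : form) :
  subst (up1 σ) ξ (step A) = step (subst (up1 σ) ξ A).
Proof.
  unfold step. rewrite !subst_comp. f_equal. apply functional_extensionality.
  intros [|n]; [reflexivity|]. simpl. now rewrite tsubst_lift.
Qed.

(** A substitution only alters the parameters of the schemata: [up1] fixes the induction or
    comprehension variable, and bounded formulas stay bounded. *)
Lemma RCA0_subst_closed : subst_closed RCA0.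
Proof.
  intros A σ ξ H. destruct H as [| | | | | | | |A (B & HB & ->)|A B (A' & HA & ->) (B' & HB & ->)];
    try (cbn; constructor; fail).
  - cbn [subst]. rewrite subst_inst1. cbn [subst tsubst].
    change (∃₁ subst (up1 (up1 σ)) ξ B) with (subst (up1 σ) ξ (∃₁ B)).
    rewrite subst_step. apply ax_Sigma01_induction.
    eexists. split; [|reflexivity]. now apply Delta00_subst.
  - unfold fiff. cbn [subst]. rewrite subst_lift2.
    apply (ax_Delta01_comprehension (subst (up1 σ) ξ (∃₁ A')) (subst (up1 σ) ξ (∀₁ B'))).
    + eexists. split; [|reflexivity]. now apply Delta00_subst.
    + eexists. split; [|reflexivity]. now apply Delta00_subst.
Qed.

(** Interleaving lets two formulas keep disjoint parameters under one assignment. *)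
Definition mix {A : Type} (f g : nat -> A) (i : nat) : A :=
  if Nat.even i then f (Nat.div2 i) else g (Nat.div2 i).

Lemma mix_even {A : Type} (f g : nat -> A) i : mix f g (2 * i) = f i.
Proof. unfold mix. now rewrite Nat.even_even, Nat.div2_double. Qed.

Lemma mix_odd {A : Type} (f g : nat -> A) i : mix f g (S (2 * i)) = g i.
Proof. unfold mix. now rewrite <- Nat.add_1_r, Nat.even_odd, Nat.add_1_r, Nat.div2_succ_double. Qed.

(** * Predicates defined by bounded formulas with parameters *)

Section Models.

Variable M : model.
Notation N := (num M).

Definition env (n : nat) (e ρ : nat -> N) (i : nat) : N :=
  if i <? n then e i else ρ (i - n).

Lemma scons_env n e ρ x : scons x (env n e ρ) = env (S n) (scons x e) ρ.
Proof.
  apply functional_extensionality. intros [|i]; [reflexivity|].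
  unfold env. simpl. reflexivity.
Qed.

(** [e] lists the first [n] variables; the remaining variables and all set
    variables are parameters fixed by the witness. *)
Definition D0 (n : nat) (φ : (nat -> N) -> Prop) : Prop :=
  exists A ρ θ, Delta00 A /\ forall e, sat M (env n e ρ) θ A <-> φ e.

Definition Tm (n : nat) (g : (nat -> N) -> N) : Prop :=
  exists t ρ, forall e, eval M (env n e ρ) t = g e.

Definition ren_l (n i : nat) : nat := if i <? n then i else n + 2 * (i - n).
Definition ren_r (n i : nat) : nat := if i <? n then i else n + S (2 * (i - n)).

Lemma env_mix_l n e ρ1 ρ2 :
  (fun i => env n e (mix ρ1 ρ2) (ren_l n i)) = env n e ρ1.
Proof.
  apply functional_extensionality. intros i. unfold env, ren_l, ren_r.
  destruct (Nat.ltb_spec i n).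
  - destruct (Nat.ltb_spec i n); [reflexivity|lia].
  - destruct (Nat.ltb_spec (n + 2 * (i - n)) n); [lia|].
    replace (n + 2 * (i - n) - n) with (2 * (i - n)) by lia. apply mix_even.
Qed.

Lemma env_mix_r n e ρ1 ρ2 :
  (fun i => env n e (mix ρ1 ρ2) (ren_r n i)) = env n e ρ2.
Proof.
  apply functional_extensionality. intros i. unfold env, ren_l, ren_r.
  destruct (Nat.ltb_spec i n).
  - destruct (Nat.ltb_spec i n); [reflexivity|lia].
  - destruct (Nat.ltb_spec (n + S (2 * (i - n))) n); [lia|].
    replace (n + S (2 * (i - n)) - n) with (S (2 * (i - n))) by lia. apply mix_odd.
Qed.

Lemma sat_mix_l n e ρ1 ρ2 θ1 θ2 A :
  sat M (env n e (mix ρ1 ρ2)) (mix θ1 θ2)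
    (subst (fun i => #(ren_l n i)) (fun X => 2 * X) A)
  <-> sat M (env n e ρ1) θ1 A.
Proof.
  rewrite sat_subst. cbn [eval]. rewrite env_mix_l.
  replace (fun X => mix θ1 θ2 (2 * X)) with θ1; [reflexivity|].
  apply functional_extensionality. intros X. symmetry. apply mix_even.
Qed.

Lemma sat_mix_r n e ρ1 ρ2 θ1 θ2 A :
  sat M (env n e (mix ρ1 ρ2)) (mix θ1 θ2)
    (subst (fun i => #(ren_r n i)) (fun X => S (2 * X)) A)
  <-> sat M (env n e ρ2) θ2 A.
Proof.
  rewrite sat_subst. cbn [eval]. rewrite env_mix_r.
  replace (fun X => mix θ1 θ2 (S (2 * X))) with θ2; [reflexivity|].
  apply functional_extensionality. intros X. symmetry. apply mix_odd.
Qed.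

Lemma eval_mix_l n e ρ1 ρ2 t :
  eval M (env n e (mix ρ1 ρ2)) (tsubst (fun i => #(ren_l n i)) t)
  = eval M (env n e ρ1) t.
Proof. rewrite eval_tsubst. cbn [eval]. now rewrite env_mix_l. Qed.

Lemma eval_mix_r n e ρ1 ρ2 t :
  eval M (env n e (mix ρ1 ρ2)) (tsubst (fun i => #(ren_r n i)) t)
  = eval M (env n e ρ2) t.
Proof. rewrite eval_tsubst. cbn [eval]. now rewrite env_mix_r. Qed.

Lemma Tm_const n c : Tm n (fun _ => c).
Proof.
  (* The variable [#n] is the first one past the listed variables, hence a parameter. *)
  exists #n, (fun _ => c). intros e. simpl. unfold env.
  destruct (Nat.ltb_spec n n); [lia|reflexivity].
Qed.

Lemma Tm_var n k : k < n -> Tm n (fun e => e k).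
Proof.
  intros H. exists #k, (fun _ => mzero M). intros e. simpl. unfold env.
  destruct (Nat.ltb_spec k n); [reflexivity|lia].
Qed.

Lemma Tm_add n g h : Tm n g -> Tm n h -> Tm n (fun e => madd M (g e) (h e)).
Proof.
  intros (s & ρ1 & Hs) (t & ρ2 & Ht). eexists (tadd _ _), (mix ρ1 ρ2). intros e.
  cbn [eval]. now rewrite <- Hs, <- Ht, eval_mix_l, eval_mix_r.
Qed.

Lemma Tm_mul n g h : Tm n g -> Tm n h -> Tm n (fun e => mmul M (g e) (h e)).
Proof.
  intros (s & ρ1 & Hs) (t & ρ2 & Ht). eexists (tmul _ _), (mix ρ1 ρ2). intros e.
  cbn [eval]. now rewrite <- Hs, <- Ht, eval_mix_l, eval_mix_r.
Qed.

Lemma Tm_shift j n g : Tm n g -> Tm (j + n) (fun e => g (fun k => e (j + k))).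
Proof.
  intros (t & ρ & Ht). exists (tsubst (fun i => #(j + i)) t), ρ. intros e.
  rewrite eval_tsubst, <- Ht. cbn [eval]. f_equal. apply functional_extensionality.
  intros i. unfold env. replace (j + i - (j + n)) with (i - n) by lia.
  destruct (Nat.ltb_spec (j + i) (j + n)), (Nat.ltb_spec i n); reflexivity || lia.
Qed.

(** A default set, which fills the set assignment of formulas without set parameters. *)
Variable X0 : sets M.

Lemma D0_atom (n : nat) (P : N -> N -> Prop) (c : term -> term -> form) g h :
  (forall s t, Delta00 (c s t)) ->
  (forall e θ s t, sat M e θ (c s t) <-> P (eval M e s) (eval M e t)) ->
  Tm n g -> Tm n h -> D0 n (fun e => P (g e) (h e)).
Proof.
  intros HD HP (s & ρ1 & Hs) (t & ρ2 & Ht).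
  eexists (c _ _), (mix ρ1 ρ2), (fun _ => X0). split; [apply HD|]. intros e.
  rewrite HP, <- Hs, <- Ht, eval_mix_l, eval_mix_r. reflexivity.
Qed.

Lemma D0_eq n g h : Tm n g -> Tm n h -> D0 n (fun e => g e = h e).
Proof. apply (D0_atom n eq feq); [constructor|reflexivity]. Qed.

Lemma D0_lt n g h : Tm n g -> Tm n h -> D0 n (fun e => mlt M (g e) (h e)).
Proof. apply (D0_atom n (mlt M) flt); [constructor|reflexivity]. Qed.

Lemma D0_mem n g X : Tm n g -> D0 n (fun e => mmem M (g e) X).
Proof.
  intros (s & ρ & Hs). exists (s ∊ 0), ρ, (fun _ => X). split; [constructor|].
  intros e. simpl. now rewrite Hs.
Qed.

Lemma D0_connective (n : nat) (P : Prop -> Prop -> Prop) (c : form -> form -> form) φ ψ :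
  (forall A B, Delta00 A -> Delta00 B -> Delta00 (c A B)) ->
  (forall e θ A B, sat M e θ (c A B) <-> P (sat M e θ A) (sat M e θ B)) ->
  (forall Q Q' R R' : Prop, (Q <-> Q') -> (R <-> R') -> (P Q R <-> P Q' R')) ->
  D0 n φ -> D0 n ψ -> D0 n (fun e => P (φ e) (ψ e)).
Proof.
  intros HD HS HP (A & ρ1 & θ1 & HA & Hφ) (B & ρ2 & θ2 & HB & Hψ).
  exists (c (subst (fun i => #(ren_l n i)) (fun X => 2 * X) A)
    (subst (fun i => #(ren_r n i)) (fun X => S (2 * X)) B)), (mix ρ1 ρ2), (mix θ1 θ2). split.
  - apply HD; now apply Delta00_subst.
  - intros e. rewrite HS. apply HP.
    + rewrite <- Hφ. apply sat_mix_l.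
    + rewrite <- Hψ. apply sat_mix_r.
Qed.

Lemma D0_and n φ ψ : D0 n φ -> D0 n ψ -> D0 n (fun e => φ e /\ ψ e).
Proof. apply (D0_connective n and fand); [now constructor|reflexivity|tauto]. Qed.

Lemma D0_or n φ ψ : D0 n φ -> D0 n ψ -> D0 n (fun e => φ e \/ ψ e).
Proof. apply (D0_connective n or for_); [now constructor|reflexivity|tauto]. Qed.

Lemma D0_imp n φ ψ : D0 n φ -> D0 n ψ -> D0 n (fun e => φ e -> ψ e).
Proof. apply (D0_connective n (fun P Q => P -> Q) fimp); [now constructor|reflexivity|tauto]. Qed.

Lemma D0_iff n φ ψ : D0 n φ -> D0 n ψ -> D0 n (fun e => φ e <-> ψ e).
Proof. intros H1 H2. apply D0_and; now apply D0_imp. Qed.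

Lemma D0_False n : D0 n (fun _ => False).
Proof.
  exists fbot, (fun _ => mzero M), (fun _ => X0). split; [constructor|]. reflexivity.
Qed.

Lemma D0_not n φ : D0 n φ -> D0 n (fun e => ~ φ e).
Proof. intros H. apply D0_imp; [exact H|apply D0_False]. Qed.

Lemma D0_ball n g (ψ : N -> (nat -> N) -> Prop) :
  Tm n g -> D0 (S n) (fun e => ψ (e 0) (fun k => e (S k))) ->
  D0 n (fun e => forall x, mlt M x (g e) -> ψ x e).
Proof.
  intros (t & ρ1 & Ht) (A & ρ2 & θ & HA & Hψ).
  exists (∀₁ (#0 ≺ tlift (tsubst (fun i => #(ren_l n i)) t) ⇒
    subst (fun i => #(ren_r (S n) i)) (fun X => S (2 * X)) A)), (mix ρ1 ρ2), (mix (fun _ => X0) θ).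
  split.
  - constructor. apply Delta00_subst, HA.
  - intros e. cbn [sat]. apply forall_iff. intros x.
    rewrite scons_env. rewrite sat_mix_r, Hψ. cbn [eval].
    rewrite <- scons_env. unfold tlift. rewrite eval_tsubst. cbn [eval scons].
    change (fun n0 => env n e (mix ρ1 ρ2) n0) with (env n e (mix ρ1 ρ2)).
    rewrite eval_mix_l, Ht. reflexivity.
Qed.

Lemma D0_bex n g (ψ : N -> (nat -> N) -> Prop) :
  Tm n g -> D0 (S n) (fun e => ψ (e 0) (fun k => e (S k))) ->
  D0 n (fun e => exists x, mlt M x (g e) /\ ψ x e).
Proof.
  intros (t & ρ1 & Ht) (A & ρ2 & θ & HA & Hψ).
  exists (∃₁ (#0 ≺ tlift (tsubst (fun i => #(ren_l n i)) t) ⩓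
    subst (fun i => #(ren_r (S n) i)) (fun X => S (2 * X)) A)), (mix ρ1 ρ2), (mix (fun _ => X0) θ).
  split.
  - constructor. apply Delta00_subst, HA.
  - intros e. cbn [sat]. apply exists_iff. intros x.
    rewrite scons_env. rewrite sat_mix_r, Hψ. cbn [eval].
    rewrite <- scons_env. unfold tlift. rewrite eval_tsubst. cbn [eval scons].
    change (fun n0 => env n e (mix ρ1 ρ2) n0) with (env n e (mix ρ1 ρ2)).
    rewrite eval_mix_l, Ht. reflexivity.
Qed.

(** * Induction and comprehension for definable predicates *)

Hypothesis HM : forall A e f, RCA0 A -> sat M e f A.

Lemma D0_sat2 φ : D0 2 φ -> exists A ρ θ, Delta00 A /\
  forall x y, sat M (scons x (scons y ρ)) θ A <-> φ (scons x (scons y ρ)).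
Proof.
  intros (A & ρ & θ & HA & H). exists A, ρ, θ. split; [exact HA|]. intros x y.
  rewrite <- H, <- !scons_env. replace (env 0 ρ ρ) with ρ; [reflexivity|].
  apply functional_extensionality. intros i. unfold env. simpl. now rewrite Nat.sub_0_r.
Qed.

(** The existential quantifier of the formula is innermost, so its witness is variable 0 and the
    induction variable is 1. *)
Theorem Sigma01_induction (φ : N -> N -> Prop) :
  D0 2 (fun e => φ (e 0) (e 1)) ->
  (exists w, φ w (mzero M)) ->
  (forall x, (exists w, φ w x) -> exists w, φ w (madd M x (mone M))) ->
  forall x, exists w, φ w x.
Proof.
  intros HD H0 HS. apply D0_sat2 in HD as (A & ρ & θ & HA & H). cbn [scons] in H.
  assert (HI := HM _ ρ θ (ax_Sigma01_induction (∃₁ A) (ex_intro _ A (conj HA eq_refl)))).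
  cbn [sat] in HI. intros x.
  assert (E : forall y e, sat M (scons y ρ) e (∃₁ A) <-> exists w, sat M (scons w (scons y ρ)) e A)
    by reflexivity.
  destruct (fun HH => HI HH x) as [w Hw].
  - split.
    + unfold inst1. rewrite sat_subst.
      replace (fun n => eval M ρ (scons tzero tvar n)) with (scons (mzero M) ρ)
        by (apply functional_extensionality; now intros [|i]).
      destruct H0 as [w Hw]. exists w. now apply H.
    + intros y [w Hw]. apply H in Hw. unfold step. rewrite sat_subst.
      replace (fun n => eval M (scons y ρ) (scons (tsucc #0) (fun k => #(S k)) n))
        with (scons (madd M y (mone M)) ρ)
        by (apply functional_extensionality; now intros [|i]).
      destruct (HS y (ex_intro _ w Hw)) as [w' Hw']. exists w'. now apply H.
  - exists w. now apply H.
Qed.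

(** A vacuous witness turns the bounded predicate into a $\Sigma^0_1$ one. *)
Theorem Delta00_induction (φ : N -> Prop) :
  D0 2 (fun e => φ (e 1)) ->
  φ (mzero M) -> (forall x, φ x -> φ (madd M x (mone M))) -> forall x, φ x.
Proof.
  intros HD H0 HS x. destruct (Sigma01_induction (fun _ => φ) HD) with (x := x) as [_ H].
  - now exists (mzero M).
  - intros y [w H]. exists w. now apply HS.
  - exact H.
Qed.

Theorem Delta01_comprehension (φ ψ : N -> N -> Prop) :
  D0 2 (fun e => φ (e 0) (e 1)) -> D0 2 (fun e => ψ (e 0) (e 1)) ->
  (forall x, (exists w, φ w x) <-> (forall w, ψ w x)) ->
  exists X, forall x, mmem M x X <-> exists w, φ w x.
Proof.
  intros (A & ρ1 & θ1 & HA & Hφ) (B & ρ2 & θ2 & HB & Hψ) HE.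
  (* The axiom is evaluated under one assignment, so the parameters of the two formulas are
     interleaved. *)
  set (A' := subst (fun i => #(ren_l 2 i)) (fun X => 2 * X) A).
  set (B' := subst (fun i => #(ren_r 2 i)) (fun X => S (2 * X)) B).
  assert (HA' : Sigma01 (∃₁ A')).
  { exists A'. split; [apply Delta00_subst, HA|reflexivity]. }
  assert (HB' : Pi01 (∀₁ B')).
  { exists B'. split; [apply Delta00_subst, HB|reflexivity]. }
  set (ρ := mix ρ1 ρ2). set (θ := mix θ1 θ2).
  assert (E : forall w x, scons w (scons x ρ) = env 2 (scons w (scons x ρ)) ρ).
  { intros w x. rewrite <- !scons_env. do 2 f_equal.
    apply functional_extensionality. intros i. unfold env. simpl. now rewrite Nat.sub_0_r. }
  assert (EA : forall w x, sat M (scons w (scons x ρ)) θ A' <-> φ w x).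
  { intros w x. rewrite E. unfold A', ρ, θ. rewrite sat_mix_l, Hφ. reflexivity. }
  assert (EB : forall w x, sat M (scons w (scons x ρ)) θ B' <-> ψ w x).
  { intros w x. rewrite E. unfold B', ρ, θ. rewrite sat_mix_r, Hψ. reflexivity. }
  destruct (HM _ ρ θ (ax_Delta01_comprehension _ _ HA' HB')) as [X HX].
  - intros x. change ((exists w, sat M (scons w (scons x ρ)) θ A') <->
      (forall w, sat M (scons w (scons x ρ)) θ B')).
    setoid_rewrite EA. setoid_rewrite EB. apply HE.
  - exists X. intros x. specialize (HX x).
    cbn [sat lift2 fiff] in HX. change (eval M (scons x ρ) #0) with x in HX.
    unfold lift2 in HX. rewrite sat_subst in HX.
    change (mmem M x X <-> sat M (scons x ρ) θ (∃₁ A')) in HX. rewrite HX.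
    apply exists_iff. intros w. apply EA.
Qed.

Theorem Delta00_comprehension (φ : N -> Prop) :
  D0 2 (fun e => φ (e 1)) -> exists X, forall x, mmem M x X <-> φ x.
Proof.
  intros HD. destruct (Delta01_comprehension (fun _ => φ) (fun _ => φ) HD HD) as [X HX].
  - intros x. split; [intros [_ H] _; exact H|]. intros H. exists (mzero M). exact (H (mzero M)).
  - exists X. intros x. rewrite HX. split; [now intros [_ H]|]. intros H. now exists (mzero M).
Qed.

(** ** Arithmetic in a model *)

Declare Scope model_scope.
Local Open Scope model_scope.
Local Notation "x + y" := (madd M x y) : model_scope.
Local Notation "x * y" := (mmul M x y) : model_scope.
Local Notation "x < y" := (mlt M x y) : model_scope.
Local Notation "x <= y" := (mlt M x (madd M y (mone M))) : model_scope.
Local Notation "0" := (mzero M) : model_scope.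
Local Notation "1" := (mone M) : model_scope.
Local Notation "x ∈ X" := (mmem M x X) (at level 70) : model_scope.

Ltac Tm_shift_solve :=
  match goal with H : Tm ?n ?g |- _ =>
    first [ exact H | exact (Tm_shift 1 n g H) | exact (Tm_shift 2 n g H)
          | exact (Tm_shift 3 n g H) | exact (Tm_shift 4 n g H) | exact (Tm_shift 5 n g H) ]
  end.

Ltac Tm_solve := solve [repeat first
  [apply Tm_const | apply Tm_var; lia | apply Tm_add | apply Tm_mul | Tm_shift_solve]].

Ltac D0_solve := repeat (cbv beta; first
  [ apply D0_iff | apply D0_and | apply D0_or | apply D0_False
  | apply D0_eq; Tm_solve | apply D0_lt; Tm_solve | apply D0_mem; Tm_solve
  | apply D0_ball; [Tm_solve|] | apply D0_bex; [Tm_solve|]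
  | apply D0_not | apply D0_imp ]).

Ltac axiom ax := generalize (HM _ (fun _ => mzero M) (fun _ => X0) ax); cbn; let K := fresh in intros K; apply K.

Lemma succ_nonzero x : x + 1 <> 0.
Proof. intros H. generalize H. axiom ax_succ_nonzero. Qed.

Lemma succ_inj x y : x + 1 = y + 1 -> x = y.
Proof. axiom ax_succ_inj. Qed.

Lemma add_0_r x : x + 0 = x.
Proof. axiom ax_add_zero. Qed.

Lemma add_succ_r x y : x + (y + 1) = (x + y) + 1.
Proof. axiom ax_add_succ. Qed.

Lemma mul_0_r x : x * 0 = 0.
Proof. axiom ax_mul_zero. Qed.

Lemma mul_succ_r x y : x * (y + 1) = x * y + x.
Proof. axiom ax_mul_succ. Qed.

Lemma lt_0_r x : ~ x < 0.
Proof. intros H. generalize H. axiom ax_lt_zero. Qed.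

Lemma lt_succ_r x y : x <= y <-> x < y \/ x = y.
Proof. generalize (HM _ (fun _ => mzero M) (fun _ => X0) ax_lt_succ x y). cbn. tauto. Qed.

Ltac Delta00_ind :=
  match goal with |- forall x, @?P x => apply (Delta00_induction P) end;
  [D0_solve|cbv beta..].

Ltac Sigma01_ind :=
  match goal with |- forall x, exists w, @?P x w =>
    apply (Sigma01_induction (fun w x => P x w)) end; [D0_solve|cbv beta..].

Lemma add_assoc x y z : x + (y + z) = (x + y) + z.
Proof.
  revert z. Delta00_ind; [now rewrite !add_0_r|].
  intros z IH. now rewrite !add_succ_r, IH.
Qed.

Lemma add_0_l x : 0 + x = x.
Proof.
  revert x. Delta00_ind; [apply add_0_r|]. intros x IH. now rewrite add_succ_r, IH.
Qed.

Lemma add_succ_l x y : (x + 1) + y = (x + y) + 1.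
Proof.
  revert y. Delta00_ind; [now rewrite !add_0_r|]. intros y IH. now rewrite !add_succ_r, IH.
Qed.

Lemma add_comm x y : x + y = y + x.
Proof.
  revert y. Delta00_ind; [now rewrite add_0_l, add_0_r|].
  intros y IH. now rewrite add_succ_r, add_succ_l, IH.
Qed.

Lemma mul_0_l x : 0 * x = 0.
Proof.
  revert x. Delta00_ind; [apply mul_0_r|]. intros x IH. now rewrite mul_succ_r, IH, add_0_r.
Qed.

Lemma mul_succ_l x y : (x + 1) * y = x * y + y.
Proof.
  revert y. Delta00_ind; [now rewrite !mul_0_r, add_0_r|].
  intros y IH. rewrite !mul_succ_r, IH, <- !add_assoc. f_equal.
  now rewrite !add_succ_r, (add_comm x y).
Qed.

Lemma mul_comm x y : x * y = y * x.
Proof.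
  revert y. Delta00_ind; [now rewrite mul_0_l, mul_0_r|].
  intros y IH. now rewrite mul_succ_r, mul_succ_l, IH.
Qed.

Lemma mul_1_l x : 1 * x = x.
Proof. rewrite <- (add_0_l 1), mul_succ_l, mul_0_l. apply add_0_l. Qed.

Lemma mul_add_distr_r x y z : (x + y) * z = x * z + y * z.
Proof.
  revert z. Delta00_ind; [now rewrite !mul_0_r, add_0_r|].
  intros z IH. rewrite !mul_succ_r, IH, <- !add_assoc. f_equal.
  rewrite !add_assoc. f_equal. apply add_comm.
Qed.

Lemma mul_assoc x y z : x * (y * z) = (x * y) * z.
Proof.
  revert z. Delta00_ind; [now rewrite !mul_0_r|].
  intros z IH. rewrite !mul_succ_r, <- IH, (mul_comm x (_ + _)), mul_add_distr_r.
  f_equal; apply mul_comm.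
Qed.

Lemma model_semiring : semi_ring_theory 0 1 (madd M) (mmul M) eq.
Proof.
  constructor; auto using add_0_l, add_comm, add_assoc, mul_1_l, mul_0_l, mul_comm,
    mul_assoc, mul_add_distr_r.
Qed.

Add Ring model_ring : model_semiring.

(** * Order and cancellation *)

Lemma zero_or_succ x : x = 0 \/ exists y, x = y + 1.
Proof.
  assert (H : exists w, x = 0 \/ x = w + 1).
  { revert x. Sigma01_ind.
    - exists 0. now left.
    - intros x _. exists x. now right. }
  destruct H as [w [H|H]]; [now left|right; now exists w].
Qed.

Lemma lt_add_succ x z : x < x + (z + 1).
Proof.
  revert z. Delta00_ind.
  - rewrite add_0_l. apply lt_succ_r. now right.
  - intros z IH. rewrite add_succ_r. apply lt_succ_r. now left.
Qed.

(** The axioms describe [<] only at zero and at successors. Expressing it by addition turns order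
    facts into identities that [ring] can check. In the proof the implication is kept inside the
    existential so that the induction is $\Sigma^0_1$. *)
Lemma lt_exists x y : x < y <-> exists z, x + (z + 1) = y.
Proof.
  split.
  - assert (H : exists z, x < y -> x + (z + 1) = y).
    { revert y. Sigma01_ind.
      - exists 0. intros H. now apply lt_0_r in H.
      - intros y [z IH]. destruct (classic (x < y)) as [H|H].
        + exists (z + 1). intros _. rewrite <- (IH H). ring.
        + exists 0. intros K. apply lt_succ_r in K as [K|K]; [easy|]. subst. ring. }
    destruct H as [z H]. intros K. exists z. now apply H.
  - intros [z <-]. apply lt_add_succ.
Qed.

Lemma le_exists x y : x <= y <-> exists z, x + z = y.
Proof.
  rewrite lt_exists. apply exists_iff. intros z. rewrite add_succ_r. split; [apply succ_inj|].
  now intros ->.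
Qed.

Lemma add_cancel_r x y z : x + z = y + z -> x = y.
Proof.
  revert z. Delta00_ind; [now rewrite !add_0_r|].
  intros z IH H. rewrite !add_succ_r in H. now apply IH, succ_inj.
Qed.

Lemma add_cancel_l x y z : z + x = z + y -> x = y.
Proof. rewrite !(add_comm z). apply add_cancel_r. Qed.

Lemma add_eq_0 x y : x + y = 0 -> x = 0 /\ y = 0.
Proof.
  destruct (zero_or_succ y) as [->|[z ->]].
  - now rewrite add_0_r.
  - rewrite add_succ_r. intros H. now apply succ_nonzero in H.
Qed.

Lemma le_refl x : x <= x.
Proof. apply lt_succ_r. now right. Qed.

Lemma le_add_r x y : x <= x + y.
Proof. apply le_exists. now exists y. Qed.

Lemma le_add_l x y : x <= y + x.
Proof. apply le_exists. exists y. apply add_comm. Qed.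

Lemma lt_le x y : x < y -> x <= y.
Proof. intros H. apply lt_succ_r. now left. Qed.

Lemma le_trans x y z : x <= y -> y <= z -> x <= z.
Proof.
  rewrite !le_exists. intros [u <-] [v <-]. exists (u + v). apply add_assoc.
Qed.

Lemma lt_le_trans x y z : x < y -> y <= z -> x < z.
Proof.
  rewrite lt_exists, le_exists, lt_exists. intros [u <-] [v <-]. exists (u + v). ring.
Qed.

Lemma le_lt_trans x y z : x <= y -> y < z -> x < z.
Proof.
  rewrite le_exists, !lt_exists. intros [u <-] [v <-]. exists (u + v). ring.
Qed.

Lemma lt_trans x y z : x < y -> y < z -> x < z.
Proof. intros H K. eapply lt_le_trans; [exact H|]. now apply lt_le. Qed.

Lemma lt_irrefl x : ~ x < x.
Proof.
  rewrite lt_exists. intros [z H]. apply (succ_nonzero z), (add_cancel_l _ _ x).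
  now rewrite add_0_r.
Qed.

Lemma lt_or_le x y : x < y \/ y <= x.
Proof.
  rewrite lt_exists, le_exists.
  assert (H : exists w, x + w = y \/ y + w = x).
  { revert x. Sigma01_ind.
    - exists y. left. apply add_0_l.
    - intros x [w [H|H]].
      + destruct (zero_or_succ w) as [->|[v ->]].
        * exists 1. right. rewrite add_0_r in H. now subst.
        * exists v. left. rewrite <- H. ring.
      + exists (w + 1). right. rewrite <- H. ring. }
  destruct H as [w [H|H]]; [|right; now exists w].
  destruct (zero_or_succ w) as [->|[v ->]]; [|left; now exists v].
  right. exists 0. rewrite <- H. ring.
Qed.

Lemma le_not_lt x y : x <= y <-> ~ y < x.
Proof.
  split.
  - intros H K. exact (lt_irrefl _ (le_lt_trans _ _ _ H K)).
  - intros H. destruct (lt_or_le y x); tauto.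
Qed.

Lemma le_antisym x y : x <= y -> y <= x -> x = y.
Proof.
  intros H K. apply lt_succ_r in H as [H|H]; [|exact H].
  now apply le_not_lt in K.
Qed.

Lemma lt_gt_cases x y : x <> y -> x < y \/ y < x.
Proof.
  intros H. destruct (lt_or_le x y) as [K|K]; [now left|right].
  apply lt_succ_r in K as [K|K]; [exact K|now subst].
Qed.

Lemma le_mul_self x : x <= x * x.
Proof.
  apply le_exists. destruct (zero_or_succ x) as [->|[y ->]].
  - exists 0. ring.
  - exists (y * (y + 1)). ring.
Qed.

(** *** Pairs *)

Definition pr (x y : N) : N := (x + y) * (x + y) + x.

Lemma pr_lt x y x' y' : x + y < x' + y' -> pr x y < pr x' y'.
Proof.
  intros H. apply lt_exists in H as [z H]. unfold pr. rewrite <- H. apply lt_exists.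
  (* The gap minus one, written out: with $s=x+y$, already $(s+1)^2$ exceeds $s^2+x$ because $x\le
     s$. *)
  exists ((x + y) * (z + 1) + z * (x + y) + z + z + z * z + y + x'). ring.
Qed.

Lemma pr_inj x y x' y' : pr x y = pr x' y' -> x = x' /\ y = y'.
Proof.
  intros H. destruct (classic (x + y = x' + y')) as [E|E].
  - unfold pr in H. rewrite E in H. apply add_cancel_l in H. subst x'.
    split; [reflexivity|]. now apply add_cancel_l in E.
  - exfalso. apply (lt_irrefl (pr x y)).
    destruct (lt_gt_cases _ _ E) as [K|K]; apply pr_lt in K; now rewrite <- H in K.
Qed.

Lemma pr_ge_l x y : x <= pr x y.
Proof. apply le_add_l. Qed.

Lemma pr_ge_r x y : y <= pr x y.
Proof.
  apply le_trans with (x + y); [apply le_add_l|].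
  apply le_trans with ((x + y) * (x + y)); [apply le_mul_self|apply le_add_r].
Qed.

(** Both components are at most the code of the pair, so the search for them is bounded and
    $\Delta^0_0$ comprehension is enough. *)
Lemma relation_comprehension (φ : N -> N -> Prop) :
  D0 2 (fun e => exists x, x <= e 1%nat /\ exists y, y <= e 1%nat /\ (e 1%nat = pr x y /\ φ x y)) ->
  exists X, (forall z, z ∈ X -> exists x y, z = pr x y) /\ forall x y, pr x y ∈ X <-> φ x y.
Proof.
  intros HD. destruct (Delta00_comprehension (fun z => exists x, x <= z /\ exists y, y <= z /\
    (z = pr x y /\ φ x y)) HD) as [X HX]. exists X. split.
  - intros z Hz. apply HX in Hz as (x & _ & y & _ & H & _). now exists x, y.
  - intros x y. rewrite HX. split.
    + intros (x' & _ & y' & _ & H & K). now apply pr_inj in H as [-> ->].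
    + intros H. exists x. split; [apply pr_ge_l|]. exists y. split; [apply pr_ge_r|]. now split.
Qed.

(** *** Coding finite sets: [i] belongs to [(a,b)] when [1 + (i+1)b] divides [a] *)

Definition dvd (d a : N) : Prop := exists m, m * d = a.

Lemma dvd_mul_l d a x : dvd d a -> dvd d (x * a).
Proof. intros [m <-]. exists (x * m). ring. Qed.

(** There is no subtraction, so the quotients are compared instead; if that of the sum is the
    smaller one, then [y] is zero. *)
Lemma dvd_sub d x y : dvd d x -> dvd d (x + y) -> dvd d y.
Proof.
  intros [k <-] [m H]. destruct (lt_or_le m k) as [K|K].
  - apply lt_exists in K as [r <-].
    assert (E : (r + 1) * d + y = 0).
    { apply (add_cancel_l _ _ (m * d)). rewrite add_0_r. rewrite H at 2. ring. }
    apply add_eq_0 in E as [_ ->]. exists 0. ring.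
  - apply le_exists in K as [r <-]. exists r. apply (add_cancel_l _ _ (k * d)).
    rewrite <- H. ring.
Qed.

Lemma dvd_succ_cancel c x : dvd (1 + c) (x * c) -> dvd (1 + c) x.
Proof.
  intros H. apply dvd_sub with (x * c); [exact H|]. exists x. ring.
Qed.

(** The moduli are those of Gödel's β function, with divisibility in place of remainders. The bound
    on [m] keeps the formula bounded. *)
Definition bit (a b i : N) : Prop := exists m, m <= a /\ m * (1 + (i + 1) * b) = a.

Lemma bit_dvd a b i : bit a b i <-> dvd (1 + (i + 1) * b) a.
Proof.
  split; [intros (m & _ & H); now exists m|].
  intros [m H]. exists m. split; [|exact H]. apply le_exists.
  exists (m * (i + 1) * b). rewrite <- H. ring.
Qed.

Lemma bit_mul_same a b i : bit (a * (1 + (i + 1) * b)) b i.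
Proof. apply bit_dvd. now exists a. Qed.

(** The moduli at [i] and [j] are coprime because [b] is divisible by the difference of the indices.
    Linear combinations and cancellation stand in for a theory of coprimality. *)
Lemma bit_mul_other a b i j :
  (forall r, i + (r + 1) = j \/ j + (r + 1) = i -> dvd (r + 1) b) -> i <> j ->
  bit (a * (1 + (j + 1) * b)) b i <-> bit a b i.
Proof.
  intros Hb Hij. rewrite !bit_dvd. split.
  - intros H.
    assert (K : exists r, dvd (r + 1) b /\ dvd (1 + (i + 1) * b) (a * (r + 1) * b)).
    { destruct (lt_gt_cases _ _ Hij) as [K|K]; apply lt_exists in K as [r Hr];
        exists r; (split; [apply Hb; auto|]).
      - apply dvd_sub with (a * (1 + (i + 1) * b)); [now exists a|].
        rewrite <- Hr in H. destruct H as [m H]. exists m. rewrite H. ring.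
      - apply dvd_sub with (a * (1 + (j + 1) * b)); [exact H|].
        exists a. rewrite <- Hr. ring. }
    destruct K as (r & [c Hc] & K).
    (* The factor [i + 1] completes [b] to [(i + 1) * b], which can be cancelled modulo its
       successor. *)
    apply (dvd_mul_l _ _ (i + 1)) in K.
    replace ((i + 1) * (a * (r + 1) * b)) with ((a * (r + 1)) * ((i + 1) * b)) in K by ring.
    apply dvd_succ_cancel in K.
    (* Since [c * (r + 1) = b], this factor turns [r + 1] into [(i + 1) * b], which cancels
       again. *)
    apply (dvd_mul_l _ _ (c * (i + 1))) in K. apply dvd_succ_cancel.
    replace (a * ((i + 1) * b)) with (c * (i + 1) * (a * (r + 1))); [exact K|].
    rewrite <- Hc. ring.
  - intros H. rewrite (mul_comm a). now apply dvd_mul_l.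
Qed.

(** In effect a factorial. That [b] is nonzero will make 1 a code of the empty set. *)
Lemma common_multiple n : exists b, b <> 0 /\ forall k, k < n -> exists m, m <= b /\ m * (k + 1) = b.
Proof.
  revert n. Sigma01_ind.
  - exists 1. split; [|intros k H; now apply lt_0_r in H].
    intros H. apply (succ_nonzero 0). now rewrite add_0_l.
  - intros n (b & Hb & IH). exists (b * (n + 1)). split.
    + intros H. apply Hb. rewrite mul_succ_r in H. now apply add_eq_0 in H.
    + assert (HD : forall k, k < n + 1 -> dvd (k + 1) (b * (n + 1))).
      { intros k Hk. apply lt_succ_r in Hk as [Hk|Hk].
        - destruct (IH k Hk) as (m & _ & Hm). rewrite mul_comm. apply dvd_mul_l. now exists m.
        - subst k. now exists b. }
      intros k Hk. destruct (HD k Hk) as [m Hm]. exists m. split; [|exact Hm].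
      apply le_exists. exists (m * k). rewrite <- Hm. ring.
Qed.

Lemma not_bit_1 b i : b <> 0 -> ~ bit 1 b i.
Proof.
  intros Hb (m & _ & H). apply Hb. destruct (zero_or_succ m) as [->|[k ->]].
  - exfalso. apply (succ_nonzero 0). rewrite add_0_l, <- H. ring.
  - assert (E : b + (i * b + k * (1 + (i + 1) * b)) = 0).
    { apply (add_cancel_r _ _ 1). rewrite add_0_l. transitivity ((k + 1) * (1 + (i + 1) * b)); [ring|exact H]. }
    now apply add_eq_0 in E.
Qed.

(** *** Definition by course-of-values recursion *)

Section Recursion.

Variable B : N -> N -> Prop.
Variable G : N -> N -> N -> Prop.
Hypothesis HB : forall n g h, Tm n g -> Tm n h -> D0 n (fun e => B (g e) (h e)).
Hypothesis HG : forall n g h k, Tm n g -> Tm n h -> Tm n k -> D0 n (fun e => G (g e) (h e) (k e)).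

Definition rec_clause (P : N -> Prop) (x i : N) : Prop :=
  B x i \/ exists j, j < i /\ (P j /\ G x i j).

Definition computes (a b x n : N) : Prop :=
  forall i, i < n -> (bit a b i <-> rec_clause (bit a b) x i).

Lemma rec_clause_ext (P P' : N -> Prop) x i :
  (forall j, j < i -> (P j <-> P' j)) -> rec_clause P x i <-> rec_clause P' x i.
Proof.
  intros H. unfold rec_clause. split; (intros [K|(j & Hj & K1 & K2)]; [now left|right]);
    exists j; (split; [exact Hj|split; [now apply H|exact K2]]).
Qed.

Ltac rec_solve := unfold computes, rec_clause, bit, pr; repeat (D0_solve;
  try (first [apply HB | apply HG]; Tm_solve)).

(** With [b] fixed, [a] is built as the product of the moduli of the members found so far. The
    invariant also keeps the bits from [k] up to [n] unset, so that a nonmember requires no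
    change. *)
Lemma computes_exists x n : exists a b, computes a b x n.
Proof.
  destruct (common_multiple n) as (b & Hb & Hm).
  assert (HD : forall i j, i < n -> j < n -> forall r, i + (r + 1) = j \/ j + (r + 1) = i ->
    dvd (r + 1) b).
  { intros i j Hi Hj r Hr. destruct (Hm r) as (m & _ & E); [|now exists m].
    destruct Hr as [Hr|Hr].
    - apply le_lt_trans with j; [|exact Hj]. apply le_exists. exists (i + 1). rewrite <- Hr. ring.
    - apply le_lt_trans with i; [|exact Hi]. apply le_exists. exists (j + 1). rewrite <- Hr. ring. }
  assert (H : forall k, exists a, k <= n ->
    computes a b x k /\ forall i, i < n -> i < k \/ ~ bit a b i).
  { match goal with |- forall k, exists a, @?P k a =>
      apply (Sigma01_induction (fun a k => P k a)) end; [rec_solve|cbv beta..].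
    - exists 1. intros _. split; [intros i Hi; now apply lt_0_r in Hi|].
      intros i _. right. now apply not_bit_1.
    - intros k [a IH]. destruct (classic (k < n)) as [Hk|Hk].
      2: { exists 0. intros K. exfalso. apply Hk.
           apply lt_exists in K as [z K]. apply lt_exists. exists z.
           apply succ_inj. rewrite <- K. ring. }
      destruct (IH (lt_le _ _ Hk)) as [IH1 IH2]. clear IH.
      destruct (classic (rec_clause (bit a b) x k)) as [HR|HR].
      (* Multiplying by the modulus of [k] sets this bit and leaves all others below [n] as they
         were. *)
      + exists (a * (1 + (k + 1) * b)). intros _.
        assert (E : forall i, i < n -> i <> k -> bit (a * (1 + (k + 1) * b)) b i <-> bit a b i).
        { intros i Hi Hik. apply bit_mul_other; [apply HD; auto|exact Hik]. }
        assert (E' : forall i, i <= k ->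
          rec_clause (bit (a * (1 + (k + 1) * b)) b) x i <-> rec_clause (bit a b) x i).
        { intros i Hi. apply rec_clause_ext. intros j Hj.
          assert (Hjk : j < k) by (eapply lt_le_trans; eauto).
          apply E; [now apply lt_trans with k|]. intros ->. now apply lt_irrefl in Hjk. }
        split.
        * intros i Hi. rewrite (E' i Hi). apply lt_succ_r in Hi as [Hi|Hi].
          -- rewrite E; [now apply IH1|now apply lt_trans with k|].
             intros ->. now apply lt_irrefl in Hi.
          -- subst i. split; [now intros _|]. intros _. apply bit_mul_same.
        * intros i Hi. rewrite lt_succ_r. destruct (classic (i = k)) as [->|Hik]; [now left; right|].
          rewrite E by auto. destruct (IH2 i Hi); auto.
      + exists a. intros _. split.
        * intros i Hi. apply lt_succ_r in Hi as [Hi|Hi]; [now apply IH1|].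
          subst i. split; [|easy]. intros K. exfalso.
          destruct (IH2 k Hk) as [K'|K']; [now apply lt_irrefl in K'|easy].
        * intros i Hi. rewrite lt_succ_r. destruct (IH2 i Hi); auto. }
  destruct (H n) as [a Ha]. exists a, b. now apply Ha, le_refl.
Qed.

Lemma computes_unique a b a' b' x n :
  computes a b x n -> computes a' b' x n -> forall i, i < n -> bit a b i <-> bit a' b' i.
Proof.
  intros H H'.
  assert (K : forall k, forall i, i < k -> i < n -> bit a b i <-> bit a' b' i).
  { unfold bit; Delta00_ind; [intros i Hi; now apply lt_0_r in Hi|].
    intros k IH i Hi Hn. rewrite (H i Hn), (H' i Hn). apply rec_clause_ext.
    intros j Hj. apply IH; [now apply lt_le_trans with i|now apply lt_trans with i]. }
  intros i Hi. now apply (K n).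
Qed.

(** Two codes of initial parts agree, so membership can be read from some code or from every code;
    hence it is $\Delta^0_1$. A common bound [w] on [a] and [b] serves as the single unbounded
    quantifier. *)
Theorem recursion : exists E, forall x i,
  pr x i ∈ E <-> rec_clause (fun j => pr x j ∈ E) x i.
Proof.
  destruct (Delta01_comprehension
    (fun w e => exists x, x <= e /\ exists i, i <= e /\ (e = pr x i /\
      exists a, a <= w /\ exists b, b <= w /\ (computes a b x (i + 1) /\ bit a b i)))
    (fun w e => exists x, x <= e /\ exists i, i <= e /\ (e = pr x i /\
      forall a, a <= w -> forall b, b <= w -> computes a b x (i + 1) -> bit a b i)))
    as [E HE].
  - rec_solve.
  - rec_solve.
  - intros e. split.
    + intros (w & x & Hx & i & Hi & He & a & _ & b & _ & Hc & Hb) w'.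
      exists x. split; [exact Hx|]. exists i. split; [exact Hi|]. split; [exact He|].
      intros a' _ b' _ Hc'. apply (computes_unique a' b' a b x (i + 1)); auto using le_refl.
    + intros H. destruct (H 0) as (x & Hx & i & Hi & He & _).
      destruct (computes_exists x (i + 1)) as (a & b & Hc).
      (* The bound [a + b] admits the code just constructed. *)
      destruct (H (a + b)) as (x' & _ & i' & _ & He' & Hb).
      rewrite He in He'. apply pr_inj in He' as [<- <-].
      exists (a + b), x. split; [exact Hx|]. exists i. split; [exact Hi|]. split; [exact He|].
      exists a. split; [apply le_add_r|]. exists b. split; [apply le_add_l|].
      split; [exact Hc|]. apply Hb; auto using le_add_r, le_add_l.
  - assert (EE : forall x n a b, computes a b x n -> forall i, i < n ->
      pr x i ∈ E <-> bit a b i).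
    { intros x n a b Hc i Hi. rewrite HE.
      assert (Hci : computes a b x (i + 1)).
      { intros j Hj. apply Hc. now apply le_lt_trans with i. }
      split.
      - intros (w & x' & _ & i' & _ & He & a' & _ & b' & _ & Hc' & Hb).
        apply pr_inj in He as [<- <-].
        apply (computes_unique a b a' b' x (i + 1)); auto using le_refl.
      - intros Hb. exists (a + b), x. split; [apply pr_ge_l|]. exists i. split; [apply pr_ge_r|].
        split; [reflexivity|].
        exists a. split; [apply le_add_r|]. exists b. split; [apply le_add_l|]. now split. }
    exists E. intros x i. destruct (computes_exists x (i + 1)) as (a & b & Hc).
    rewrite (EE x (i + 1) a b Hc i (le_refl i)), (Hc i (le_refl i)). apply rec_clause_ext.
    intros j Hj. symmetry. apply (EE x (i + 1) a b Hc). apply lt_le, Hj.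
Qed.

End Recursion.

(** * The interval representation *)

Section Representation.

Variables P R : sets M.

Definition le (p q : N) : Prop := pr p q ∈ R.
Definition slt (p q : N) : Prop := le p q /\ p <> q.

Hypothesis le_transitive : forall p q r, le p q -> le q r -> le p r.
Hypothesis le_antisymmetric : forall p q, le p q -> le q p -> p = q.
Hypothesis no22 : forall p0 q0 p1 q1, slt p0 q0 -> slt p1 q1 -> le p0 q1 \/ le p1 q0.
Hypothesis no31 : forall p0 p1 p2 q, slt p0 p1 -> slt p1 p2 -> q ∈ P -> le p0 q \/ le q p2.

Lemma slt_irrefl p : ~ slt p p.
Proof. now intros [_ H]. Qed.

Lemma slt_trans p q r : slt p q -> slt q r -> slt p r.
Proof.
  intros [H1 H2] [H3 H4]. split; [eapply le_transitive; eauto|].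
  intros <-. now apply H2, le_antisymmetric.
Qed.

Lemma le_cases p q : le p q -> p = q \/ slt p q.
Proof. intros H. destruct (classic (p = q)); [now left|right; now split]. Qed.

(** In the equality case of one alternative, transitivity gives the strict form of the other. *)
Lemma no22_slt p0 q0 p1 q1 : slt p0 q0 -> slt p1 q1 -> slt p0 q1 \/ slt p1 q0.
Proof.
  intros H1 H2. destruct (no22 _ _ _ _ H1 H2) as [H|H]; apply le_cases in H as [->|H]; auto.
  - right. eapply slt_trans; eauto.
  - left. eapply slt_trans; eauto.
Qed.

Lemma no31_slt p0 p1 p2 q :
  slt p0 p1 -> slt p1 p2 -> q ∈ P -> slt p0 q \/ slt q p2.
Proof.
  intros H1 H2 Hq. pose proof (slt_trans _ _ _ H1 H2) as H3.
  destruct (no31 _ _ _ _ H1 H2 Hq) as [H|H]; apply le_cases in H as [->|H]; auto.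
Qed.

(** The order of left (or right) endpoints, as far as the elements below [m]
    can tell. *)
Definition shift (m p q : N) : Prop :=
  forall w, w < m -> w ∈ P -> (slt w p -> slt w q) /\ (slt q w -> slt p w).

Lemma not_shift m p q : ~ shift m p q ->
  exists w, (slt w p /\ ~ slt w q) \/ (slt q w /\ ~ slt p w).
Proof.
  intros H. apply NNPP. intros HN. apply H. intros w _ _.
  split; intros K; apply NNPP; intros K'; apply HN; exists w; tauto.
Qed.

(** Take witnesses against both directions. Two predecessors or two successors produce a
    $\mathbf{2}\oplus\mathbf{2}$; one of each kind produces a chain of three through [p] or [q], and
    a $\mathbf{3}\oplus\mathbf{1}$ with the other element. *)
Lemma shift_total m p q : p ∈ P -> q ∈ P -> shift m p q \/ shift m q p.
Proof.
  intros Hp Hq. apply NNPP. intros HN. apply not_or_and in HN as [H1 H2].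
  apply not_shift in H1 as [a [[A1 A2]|[A1 A2]]];
    apply not_shift in H2 as [b [[B1 B2]|[B1 B2]]].
  - destruct (no22_slt _ _ _ _ A1 B1); auto.
  - destruct (no31_slt _ _ _ q A1 B1); auto.
  - destruct (no31_slt _ _ _ p B1 A1); auto.
  - destruct (no22_slt _ _ _ _ A1 B1); auto.
Qed.

Lemma shift_trans m p q r : shift m p q -> shift m q r -> shift m p r.
Proof. intros H1 H2 w Hw HP. destruct (H1 w Hw HP), (H2 w Hw HP). tauto. Qed.

Lemma shift_decreasing m m' p q : m <= m' -> shift m' p q -> shift m p q.
Proof. intros Hm H w Hw. apply H. now apply lt_le_trans with m. Qed.

(** In terms of endpoints: the left end of [p] is before the right end of [q], which is before the
    left end of [r]. With the dual lemma below, this is transitivity through an endpoint of the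
    other kind, valid at every stage. *)
Lemma shift_of_overlap_left m p q r : p ∈ P -> q ∈ P -> ~ slt q p -> slt q r -> shift m p r.
Proof.
  intros Hp Hq H1 H2 w _ _. split; intros K.
  - destruct (no22_slt _ _ _ _ K H2); tauto.
  - destruct (no31_slt _ _ _ p H2 K); tauto.
Qed.

Lemma shift_of_overlap_right m p q r : q ∈ P -> r ∈ P -> slt p q -> ~ slt r q -> shift m p r.
Proof.
  intros Hq Hr H1 H2 w _ _. split; intros K.
  - destruct (no31_slt _ _ _ r K H1); tauto.
  - destruct (no22_slt _ _ _ _ H1 K); tauto.
Qed.

(** The number [ix false p] stands for the left and [ix true p] for the right
    endpoint of the interval of [p]. *)
Definition ix (s : bool) (p : N) : N := if s then (p + p) + 1 else p + p.

(** * Endpoints and their order at a stage *)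

Lemma add_self_inj p q : p + p = q + q -> p = q.
Proof.
  assert (H : forall x y, x < y -> x + x <> y + y).
  { intros x y K E. apply lt_exists in K as [z <-].
    apply (succ_nonzero (z + (z + 1))), (add_cancel_l _ _ (x + x)).
    rewrite add_0_r. transitivity ((x + (z + 1)) + (x + (z + 1))); [ring|now symmetry]. }
  intros E. apply NNPP. intros K. apply lt_gt_cases in K as [K|K]; apply H in K; auto.
Qed.

Lemma odd_neq_even p q : (p + p) + 1 <> q + q.
Proof.
  intros E. destruct (lt_or_le p q) as [K|K].
  - apply lt_exists in K as [z <-].
    apply (succ_nonzero (z + z)), (add_cancel_l _ _ ((p + p) + 1)).
    rewrite add_0_r. transitivity ((p + (z + 1)) + (p + (z + 1))); [ring|now symmetry].
  - apply le_exists in K as [z <-].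
    apply (succ_nonzero (z + z)), (add_cancel_l _ _ (q + q)).
    rewrite add_0_r. transitivity (((q + z) + (q + z)) + 1); [ring|exact E].
Qed.

Lemma ix_inj s t p q : ix s p = ix t q -> s = t /\ p = q.
Proof.
  destruct s, t; simpl; intros H.
  - apply succ_inj, add_self_inj in H. auto.
  - now apply odd_neq_even in H.
  - symmetry in H. now apply odd_neq_even in H.
  - apply add_self_inj in H. auto.
Qed.

Lemma ix_ge s p : p <= ix s p.
Proof.
  destruct s; simpl; [|apply le_add_r]. apply le_exists. exists (p + 1). ring.
Qed.

(** Comparisons between a left and a right endpoint are exact; only those between endpoints of the
    same kind depend on the stage. *)
Definition end_le (m : N) (s : bool) (p : N) (t : bool) (q : N) : Prop :=
  match s, t with
  | false, true => ~ slt q p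
  | true, false => slt p q
  | _, _ => shift m p q
  end.

(** In four of the mixed cases [p] or [r] itself is the test element of [shift], which is why both
    are taken below [m]. *)
Lemma end_le_trans m s p t q u r :
  p ∈ P -> q ∈ P -> r ∈ P -> p < m -> r < m ->
  end_le m s p t q -> end_le m t q u r -> end_le m s p u r.
Proof.
  intros Hp Hq Hr Lp Lr. destruct s, t, u; simpl; intros H1 H2;
    eauto using shift_trans, shift_of_overlap_left, shift_of_overlap_right.
  - now apply (H1 r).
  - now apply (H2 p).
  - intros K. now apply H1, (H2 p).
  - intros K. now apply H2, (H1 r).
Qed.

Lemma end_le_total m s p t q : p ∈ P -> q ∈ P -> end_le m s p t q \/ end_le m t q s p.
Proof.
  intros Hp Hq. destruct s, t; simpl; auto using shift_total.
  - apply classic.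
  - destruct (classic (slt q p)); auto.
Qed.

(** The approximation at stage [m] of the order of all endpoints. *)
Definition elt (m x y : N) : Prop :=
  exists p, p <= x /\ exists q, q <= y /\ (p ∈ P /\ q ∈ P /\
   ((x = p + p /\ y = q + q /\ shift m p q)
    \/ (x = (p + p) + 1 /\ y = (q + q) + 1 /\ shift m p q)
    \/ (x = (p + p) + 1 /\ y = q + q /\ slt p q)
    \/ (x = p + p /\ y = (q + q) + 1 /\ ~ slt q p))).

Lemma elt_iff m x y : elt m x y <->
  exists s p t q, x = ix s p /\ y = ix t q /\ p ∈ P /\ q ∈ P /\ end_le m s p t q.
Proof.
  split.
  - intros (p & _ & q & _ & Hp & Hq & H).
    destruct H as [(-> & -> & H)|[(-> & -> & H)|[(-> & -> & H)|(-> & -> & H)]]].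
    + now exists false, p, false, q.
    + now exists true, p, true, q.
    + now exists true, p, false, q.
    + now exists false, p, true, q.
  - intros (s & p & t & q & -> & -> & Hp & Hq & H).
    exists p. split; [apply ix_ge|]. exists q. split; [apply ix_ge|].
    split; [exact Hp|]. split; [exact Hq|]. destruct s, t; simpl in *; auto 6.
Qed.

Lemma elt_ix m s p t q : p ∈ P -> q ∈ P -> elt m (ix s p) (ix t q) <-> end_le m s p t q.
Proof.
  intros Hp Hq. rewrite elt_iff. split.
  - intros (s' & p' & t' & q' & E1 & E2 & _ & _ & H).
    apply ix_inj in E1 as [-> ->]. now apply ix_inj in E2 as [-> ->].
  - intros H. now exists s, p, t, q.
Qed.

Definition endpoint (x : N) : Prop := exists s p, x = ix s p /\ p ∈ P.

Lemma elt_endpoint m x y : elt m x y -> endpoint x /\ endpoint y.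
Proof.
  rewrite elt_iff. intros (s & p & t & q & -> & -> & Hp & Hq & _).
  split; [now exists s, p|now exists t, q].
Qed.

Lemma elt_trans m x y z : x < m -> z < m -> elt m x y -> elt m y z -> elt m x z.
Proof.
  intros Hx Hz H1 H2. destruct (elt_endpoint _ _ _ H1) as [(s & p & -> & Hp) (t & q & -> & Hq)].
  destruct (elt_endpoint _ _ _ H2) as [_ (u & r & -> & Hr)].
  rewrite elt_ix in * by assumption.
  apply end_le_trans with t q; auto; eapply le_lt_trans; eauto using ix_ge.
Qed.

Lemma elt_total m x y : endpoint x -> endpoint y -> elt m x y \/ elt m y x.
Proof.
  intros (s & p & -> & Hp) (t & q & -> & Hq). rewrite !elt_ix by assumption.
  now apply end_le_total.
Qed.

Lemma elt_decreasing m m' x y : m <= m' -> elt m' x y -> elt m x y.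
Proof.
  intros Hm. rewrite !elt_iff. intros (s & p & t & q & H1 & H2 & Hp & Hq & H).
  exists s, p, t, q. repeat (split; [assumption|]).
  destruct s, t; simpl in *; eauto using shift_decreasing.
Qed.

(** A number [x = pr n y] is a point of the linear order: the cut immediately
    after [y] in the order of endpoints at stage [x].  The padding [n] makes
    the stage arbitrarily late.  Endpoints born later are put to the left of
    the point exactly when, at their birth, they lie below an endpoint already
    on the left. *)
Definition cut_base (x i : N) : Prop :=
  i < x /\ exists n, n <= x /\ exists y, y < x /\ (x = pr n y /\ elt x i y).

Definition cut_next (x i j : N) : Prop := x <= i /\ elt (i + 1) i j.

(** * Closure of cuts under the stage orders *)

Variable E : sets M.
Hypothesis HE : forall x i, pr x i ∈ E <-> rec_clause cut_base cut_next (fun j => pr x j ∈ E) x i.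

Definition left_of (i x : N) : Prop := pr x i ∈ E.

Lemma left_of_base x i : i < x -> left_of i x <-> cut_base x i.
Proof.
  intros Hi. unfold left_of. rewrite HE. split; [|now left].
  intros [H|(j & _ & _ & H & _)]; [exact H|]. now apply le_not_lt in H.
Qed.

Lemma left_of_next x i : x <= i ->
  left_of i x <-> exists j, j < i /\ left_of j x /\ elt (i + 1) i j.
Proof.
  intros Hi. unfold left_of. rewrite HE. split.
  - intros [[H _]|(j & Hj & H & _ & K)]; [now apply le_not_lt in Hi|]. now exists j.
  - intros (j & Hj & H & K). right. exists j. repeat split; assumption.
Qed.

Lemma left_of_endpoint x i : left_of i x -> endpoint i.
Proof.
  unfold left_of. rewrite HE. intros [(_ & n & _ & y & _ & _ & H)|(j & _ & _ & _ & H)];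
    now apply elt_endpoint in H.
Qed.

Ltac def_solve :=
  unfold left_of, cut_base, cut_next, elt, shift, slt, le, pr; D0_solve.

(** The orders shrink as the stage grows, so closure survives from [k] to [k + 1] among the old
    endpoints. Only the newcomer [k] is at issue, and the recursive clause is made for it. *)
Lemma left_of_closed x k : x <= k ->
  forall i, i < k -> forall j, j < k -> left_of j x -> elt k i j -> left_of i x.
Proof.
  revert k.
  match goal with |- forall k, @?Q k => apply (Delta00_induction Q) end; [def_solve|cbv beta..].
  - intros _ i Hi. now apply lt_0_r in Hi.
  - intros k IH Hx i Hi j Hj Hl H. apply lt_succ_r in Hx as [Hx|Hx].
    + specialize (IH Hx).
      assert (Hd : forall a b, elt (k + 1) a b -> elt k a b).
      { intros a b. apply elt_decreasing, lt_le, le_refl. }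
      apply lt_succ_r in Hi as [Hi|Hi]; apply lt_succ_r in Hj as [Hj|Hj].
      * apply (IH i Hi j Hj); auto.
      (* A newcomer [k] on the left has an older endpoint on the left above it, and that one bounds
         [i]. *)
      * subst j. apply left_of_next in Hl as (j & Hj & Hl & K); [|exact Hx].
        apply (IH i Hi j Hj Hl), Hd. apply elt_trans with k; auto using lt_le.
      * subst i. apply left_of_next; eauto.
      * now subst.
    (* At its own stage [x] the cut is an initial segment by definition. *)
    + subst x. rewrite left_of_base in * by assumption.
      destruct Hl as (_ & n & Hn & y & Hy & Hxy & K).
      split; [exact Hi|]. exists n. split; [exact Hn|]. exists y. split; [exact Hy|].
      split; [exact Hxy|]. now apply elt_trans with j.
Qed.

Lemma left_of_down x i j : left_of j x -> (forall k, elt k i j) -> left_of i x.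
Proof.
  intros Hl H. apply (left_of_closed x (x + (i + j + 1))) with j; auto.
  - apply le_add_r.
  - apply lt_exists. exists (x + j). ring.
  - apply lt_exists. exists (x + i). ring.
Qed.

(** By the preceding closure, a cut between two endpoints yields a stage that tells them apart;
    later arguments then cut at such a stage. *)
Lemma left_of_separated x i j :
  left_of j x -> ~ left_of i x -> exists m, ~ elt m i j.
Proof.
  intros H1 H2. apply NNPP. intros HN. apply H2, (left_of_down x i j H1).
  intros k. apply NNPP. intros K. apply HN. now exists k.
Qed.

(** * Linear order of the points *)

Definition below (x y : N) : Prop := forall i, i < x + y -> left_of i x -> left_of i y.

(** Past [x + y] both cuts grow by the same clause, so an inclusion below that bound persists.
    Inclusion is therefore a bounded property. *)
Lemma below_iff x y : below x y <-> forall i, left_of i x -> left_of i y.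
Proof.
  split; [|intros H i _; apply H]. intros H i.
  assert (K : forall k, forall i, i < k -> left_of i x -> left_of i y).
  { match goal with |- forall k, @?Q k => apply (Delta00_induction Q) end; [def_solve|cbv beta..].
    - intros j Hj. now apply lt_0_r in Hj.
    - intros k IH j Hj Hl. destruct (lt_or_le j (x + y)) as [L|L]; [now apply H|].
      assert (Hx : x <= j) by (apply le_trans with (x + y); [apply le_add_r|exact L]).
      assert (Hy : y <= j) by (apply le_trans with (x + y); [apply le_add_l|exact L]).
      apply left_of_next in Hl as (l & Hlj & Hl & Hel); [|exact Hx].
      apply left_of_next; [exact Hy|]. exists l. repeat split; auto.
      apply IH; auto. now apply lt_le_trans with j. }
  apply (K (i + 1)), le_refl.
Qed.

Lemma below_total x y : below x y \/ below y x.
Proof.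
  rewrite !below_iff. apply NNPP. intros HN. apply not_or_and in HN as [H1 H2].
  apply not_all_ex_not in H1 as [i Hi], H2 as [j Hj].
  apply imply_to_and in Hi as [Hi1 Hi2], Hj as [Hj1 Hj2].
  (* A stage past both points and both endpoints; there the two cuts are initial segments of one
     total preorder. *)
  set (k := x + (y + (i + (j + 1)))).
  assert (Hxk : x <= k) by apply le_add_r.
  assert (Hyk : y <= k) by (apply le_exists; exists (x + (i + (j + 1))); unfold k; ring).
  assert (Hik : i < k) by (apply lt_exists; exists (x + (y + j)); unfold k; ring).
  assert (Hjk : j < k) by (apply lt_exists; exists (x + (y + i)); unfold k; ring).
  destruct (elt_total k i j) as [H|H]; eauto using left_of_endpoint.
  - apply Hi2, (left_of_closed y k) with j; auto.
  - apply Hj2, (left_of_closed x k) with i; auto.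
Qed.

Lemma below_trans x y z : below x y -> below y z -> below x z.
Proof. rewrite !below_iff. auto. Qed.

Lemma below_refl x : below x x.
Proof. apply below_iff. auto. Qed.

(** Points determining the same cut are ordered by their numbers. *)
Definition pt_le (x y : N) : Prop := below x y /\ (below y x -> x <= y).

Lemma pt_le_refl x : pt_le x x.
Proof. split; [apply below_refl|]. intros _. apply le_refl. Qed.

Lemma pt_le_trans x y z : pt_le x y -> pt_le y z -> pt_le x z.
Proof.
  intros [H1 H2] [H3 H4]. split; [now apply below_trans with y|]. intros H.
  apply le_trans with y; [apply H2|apply H4]; eapply below_trans; eauto.
Qed.

Lemma pt_le_antisym x y : pt_le x y -> pt_le y x -> x = y.
Proof. intros [H1 H2] [H3 H4]. apply le_antisym; auto. Qed.

Lemma pt_le_total x y : pt_le x y \/ pt_le y x.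
Proof.
  destruct (classic (below x y)) as [H|H], (classic (below y x)) as [K|K].
  - destruct (lt_or_le x y) as [L|L]; [left|right]; split; auto using lt_le.
  - left. now split.
  - right. now split.
  - destruct (below_total x y); tauto.
Qed.

Lemma pt_lt_of_separated i x y : ~ left_of i x -> left_of i y -> pt_le x y /\ x <> y.
Proof.
  intros Hx Hy. split; [|now intros ->]. destruct (pt_le_total x y) as [H|[H _]]; [exact H|].
  exfalso. rewrite below_iff in H. auto.
Qed.

(** * Points and the intervals they form *)

Lemma point_exists m y : exists x, m <= x /\ y < x /\ forall i, i < x -> left_of i x <-> elt x i y.
Proof.
  (* The padding lifts the code above [m] and [y]; the extra 1 makes the bound on [y] strict. *)
  exists (pr (m + y + 1) y).
  assert (H1 : m + y + 1 <= pr (m + y + 1) y) by apply pr_ge_l.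
  assert (Hm : m <= pr (m + y + 1) y).
  { eapply le_trans; [|exact H1]. apply le_exists. exists (y + 1). ring. }
  assert (Hy : y < pr (m + y + 1) y).
  { eapply lt_le_trans; [|exact H1]. apply lt_exists. exists m. ring. }
  split; [exact Hm|]. split; [exact Hy|]. intros i Hi. rewrite left_of_base by exact Hi. split.
  - intros (_ & n & _ & y' & _ & He & H). now apply pr_inj in He as [_ <-].
  - intros H. split; [exact Hi|]. exists (m + y + 1). split; [exact H1|].
    exists y. repeat split; assumption.
Qed.

(** [x] belongs to the interval of [p]. *)
Definition val (p x : N) : Prop :=
  p ∈ P /\ left_of (ix false p) x /\ ~ left_of (ix true p) x.

(** The stage is late enough for all four endpoints of [p] and [q] to be older than the point, so
    that its base clause alone decides their sides. *)
Lemma point_ix_exists m s r p q : r ∈ P -> p ∈ P -> q ∈ P -> exists x, m <= x /\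
  forall t, (left_of (ix t p) x <-> end_le x t p s r) /\
            (left_of (ix t q) x <-> end_le x t q s r).
Proof.
  intros Hr Hp Hq.
  destruct (point_exists (m + (ix true p + ix true q + 1)) (ix s r)) as (x & H1 & _ & H).
  assert (Hlt : forall t p', ix t p' <= ix true p').
  { intros [] p'; [apply le_refl|]. apply lt_le, le_refl. }
  exists x. split; [eapply le_trans; [apply le_add_r|exact H1]|]. intros t.
  split; rewrite H; try (now apply elt_ix); (eapply lt_le_trans; [|exact H1]);
    (eapply le_lt_trans; [apply Hlt|]); apply lt_exists.
  - exists (m + ix true q). ring.
  - exists (m + ix true p). ring.
Qed.

(** The cut just after the later of the two left endpoints lies in both intervals. Which one is
    later may depend on the stage of the cut. *)
Lemma val_common p q : p ∈ P -> q ∈ P -> ~ slt p q -> ~ slt q p -> exists x, val p x /\ val q x.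
Proof.
  intros Hp Hq Hpq Hqp.
  assert (K : forall m a, shift m a a) by (intros m a w _ _; auto).
  destruct (point_ix_exists 0 false p p q) as (x & _ & Hx); auto.
  destruct (point_ix_exists 0 false q p q) as (y & _ & Hy); auto.
  destruct (classic (shift x q p)) as [Hs|Hs].
  - exists x. destruct (Hx false) as [H1 H2], (Hx true) as [H3 H4]. simpl in *.
    unfold val. simpl. rewrite H1, H2, H3, H4. auto using slt_irrefl.
  - exists y. destruct (Hy false) as [H1 H2], (Hy true) as [H3 H4]. simpl in *.
    assert (shift y p q).
    (* Failure at stage [x] persists to stage [x + y]; totality there gives the other comparison,
       which descends to stage [y]. *)
    { destruct (shift_total (x + y) p q) as [H|H]; auto.
      - eapply shift_decreasing; [|exact H]. apply le_add_l.
      - destruct Hs. eapply shift_decreasing; [|exact H]. apply le_add_r. }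
    unfold val. simpl. rewrite H1, H2, H3, H4. auto using slt_irrefl.
Qed.

Lemma val_nonempty p : p ∈ P -> exists x, val p x.
Proof.
  intros Hp. destruct (val_common p p) as (x & Hx & _); eauto using slt_irrefl.
Qed.

Lemma val_convex p x y z : val p x -> val p y -> pt_le x z -> pt_le z y -> val p z.
Proof.
  intros (Hp & Hx & _) (_ & _ & Hy) [H1 _] [H2 _]. rewrite below_iff in H1, H2.
  repeat split; auto.
Qed.

(** For the converse, an overlap gives a common point, and [slt q p] gives points in the wrong
    order. *)
Lemma val_represents p q : p ∈ P -> q ∈ P ->
  slt p q <-> (forall x y, val p x -> val q y -> pt_le x y /\ x <> y).
Proof.
  intros Hp Hq. split.
  - intros H x y (_ & _ & Hx) (_ & Hy & _). apply pt_lt_of_separated with (ix true p); auto.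
    apply (left_of_down y _ _ Hy). intros k. now apply elt_ix.
  - intros H. apply NNPP. intros Hpq. destruct (classic (slt q p)) as [Hqp|Hqp].
    + destruct (val_nonempty p Hp) as [x Hx], (val_nonempty q Hq) as [y Hy].
      destruct (H x y Hx Hy) as [H1 H2]. apply H2, pt_le_antisym; auto.
      apply (pt_lt_of_separated (ix true q)).
      * apply Hy.
      * apply (left_of_down x _ (ix false p)); [apply Hx|]. intros k. now apply elt_ix.
    + destruct (val_common p q) as (x & Hx & Hy); auto. now destruct (H x x Hx Hy).
Qed.

Lemma val_common_overlap p q x : val p x -> val q x -> ~ slt p q.
Proof.
  intros Hx Hy H. pose proof Hx as [Hp _]. pose proof Hy as [Hq _].
  now apply (proj1 (val_represents p q Hp Hq) H x x Hx Hy).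
Qed.

(** The same relation [shift] compares left endpoints and right endpoints, so if [q] begins strictly
    before [p] at some stage, it also ends strictly before [p] there, and conversely. *)
Lemma val_proper p q : p ∈ P -> q ∈ P ->
  (forall x, val p x -> val q x) -> forall x, val q x -> val p x.
Proof.
  intros Hp Hq Hs x (_ & Hx1 & Hx2).
  assert (K : forall m a, shift m a a) by (intros m a w _ _; auto).
  destruct (val_nonempty p Hp) as [x0 Hx0].
  assert (Hpq : ~ slt p q) by (apply val_common_overlap with x0; auto).
  assert (Hqp : ~ slt q p) by (apply val_common_overlap with x0; auto).
  split; [exact Hp|]. split.
  - apply NNPP. intros HN.
    destruct (left_of_separated _ _ _ Hx1 HN) as [m Hm]. rewrite elt_ix in Hm by auto. simpl in Hm.
    (* The cut just after the right end of [q], late enough that the right end of [p] lies beyond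
       it: a point of [p] but not of [q]. *)
    destruct (point_ix_exists m true q p q) as (y & Hy & H); auto.
    destruct (H false) as [H1 H2], (H true) as [H3 H4]. simpl in *.
    destruct (Hs y) as (_ & _ & []); [|now apply H4, K].
    split; [exact Hp|]. simpl. rewrite H1, H3. split; [assumption|].
    intros L. apply Hm. now apply shift_decreasing with y.
  - intros HN.
    destruct (left_of_separated _ _ _ HN Hx2) as [m Hm]. rewrite elt_ix in Hm by auto. simpl in Hm.
    (* Dually, the cut just after the left end of [p] does not contain the left end of [q]. *)
    destruct (point_ix_exists m false p p q) as (y & Hy & H); auto.
    destruct (H false) as [H1 H2], (H true) as [H3 H4]. simpl in *.
    destruct (Hs y) as (_ & L & _).
    + split; [exact Hp|]. simpl. rewrite H1, H3. split; [apply K|apply slt_irrefl].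
    + simpl in L. rewrite H2 in L. apply Hm. now apply shift_decreasing with y.
Qed.

End Representation.

(** * Assembling the linear order and the intervals in the model *)

Ltac rep_solve :=
  unfold val, pt_le, below, left_of, ix, cut_base, cut_next, elt, shift, slt, le, pr; D0_solve.

Theorem proper_interval_order_sat e f P R :
  sat M e (scons R (scons P f))
    (partial_order 1 0 ⇒ no_2_plus_2 1 0 ⇒ no_3_plus_1 1 0 ⇒ proper_interval_order 1 0)%form.
Proof.
  cbn. intros [Hsub [_ [Htr Hanti]]] H22 H31.
  assert (Hdom : forall p q, le R p q -> p ∈ P /\ q ∈ P).
  { intros p q H. apply Hsub in H as (p' & q' & Hp & Hq & H).
    now apply (pr_inj p q p' q') in H as [-> ->]. }
  assert (Htr' : forall p q r, le R p q -> le R q r -> le R p r).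
  { intros p q r H1 H2. apply (Htr p) with q; auto; now apply Hdom in H1, H2. }
  assert (Hanti' : forall p q, le R p q -> le R q p -> p = q).
  { intros p q H1 H2. apply Hanti; auto; now apply Hdom in H1. }
  assert (H22' : forall p0 q0 p1 q1, slt R p0 q0 -> slt R p1 q1 -> le R p0 q1 \/ le R p1 q0).
  { intros p0 q0 p1 q1 H1 H2. apply H22; auto;
      apply proj1, Hdom in H1, H2; tauto. }
  assert (H31' : forall p0 p1 p2 q, slt R p0 p1 -> slt R p1 p2 -> q ∈ P -> le R p0 q \/ le R q p2).
  { intros p0 p1 p2 q H1 H2. intros Hq. apply (H31 p0) with p1; auto;
      apply proj1, Hdom in H1, H2; tauto. }
  clear Hsub Htr Hanti H22 H31.
  destruct (recursion (cut_base P R) (cut_next P R)) as [E HE].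
  { intros n g h Hg Hh. rep_solve. }
  { intros n g h k Hg Hh Hk. rep_solve. }
  (* Every number may serve as a point; one that codes no cut determines the empty cut. *)
  destruct (Delta00_comprehension (fun x => x = x)) as [L HL]; [D0_solve|].
  destruct (relation_comprehension (pt_le E)) as [Q [HQp HQ]]; [rep_solve|].
  destruct (relation_comprehension (val P E)) as [F [HFp HF]]; [rep_solve|].
  exists L, Q, F. unfold pr in HQ, HF.
  assert (HL' : forall x, x ∈ L) by (intros x; now apply HL).
  assert (Hlin : forall x y, (x + y) * (x + y) + x ∈ Q /\ (x = y -> False) <->
    pt_le E x y /\ x <> y) by (intros x y; now rewrite HQ).
  split; [split; [split; [|split; [|split]]|]|split; [|split; [split|split]]].
  - intros z Hz. destruct (HQp z Hz) as (x & y & ->). now exists x, y.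
  - intros x _. apply HQ, (pt_le_refl P R E HE).
  - intros x _ y _ z _. rewrite !HQ. apply (pt_le_trans P R E HE).
  - intros x _ y _. rewrite !HQ. apply pt_le_antisym.
  - intros x _ y _. rewrite !HQ. eapply pt_le_total; eauto.
  - intros z Hz. destruct (HFp z Hz) as (p & x & ->). exists p, x.
    split; [|now split]. apply HF in Hz. apply Hz.
  - intros p Hp. destruct (val_nonempty P R) with E p as [x Hx]; auto.
    exists x. now apply HF.
  - intros p _ x _ y _ z _. rewrite !HF, !Hlin. intros Hx Hy [H1 _] [H2 _].
    now apply (val_convex P R E HE p x y z).
  - intros p Hp q Hq. change ((p + q) * (p + q) + p ∈ R /\ (p = q -> False)) with (slt R p q).
    assert (HV := val_represents P R Htr' Hanti' H22' H31' E HE p q Hp Hq). split.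
    + intros H x _ y _. rewrite !HF, Hlin. now apply HV.
    + intros H. apply HV. intros x y Hx Hy. apply Hlin. apply H; auto; now apply HF.
  - intros p Hp q Hq H x. rewrite !HF. split; [rewrite <- !HF; apply H|].
    apply (val_proper P R Htr' Hanti' H22' H31' E HE); auto. intros y. rewrite <- !HF. apply H.
Qed.

End Models.

Theorem theorem6p18 :
  provable RCA0
    (∀₂ ∀₂ (partial_order 1 0 ⇒ no_2_plus_2 1 0 ⇒ no_3_plus_1 1 0 ⇒
            proper_interval_order 1 0)).
Proof.
  apply completeness; [exact RCA0_subst_closed|].
  intros M HM e f P R.
  (* The assignment provides [f 0] as the default set. *)
  exact (proper_interval_order_sat M (f 0) HM e f P R).
Qed.
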